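(* Let $\sigma,\omega\in\mathcal M_+(X)$, let $K$ be a quasi-metric kernel on $X$, and let $1<q<\infty$, $\frac1p+\frac1q=1$. Then the following are equivalent. (1) $K\omega\in\mathcal Z_{q,K}$; that is, for some $\epsilon>0$ the equation $u=Ku^q+\epsilon\,K\omega$ ($\sigma$-a.e.) has a solution $u\in L^0_+(\sigma)$. (2) $\omega$ satisfies both the infinitesimal inequality $$\sup_{x\in X,\ a>0}\left(\int_0^a\frac{|B_t(x)|_\sigma}{t^2}\,dt\right)\left(\int_a^\infty\frac{|B_t(x)|_\omega}{t^2}\,dt\right)^{q/p}<\infty$$ and the weighted norm inequality: there is a constant $C$ with $\int_X (K g)^p\,d\omega\le C\int_X g^p\,d\sigma$ for all $0\le g\in L^p(\sigma)$. (3) $\omega$ satisfies both the infinitesimal inequality displayed in (2) and the testing inequality: there is a constant $C$ such that $\int_B (K\omega_B)^q\,d\sigma\le C\,|B|_\omega$ for every ball $B=B_a(x)$, $x\in X$, $a>0$, where $d\omega_B=\chi_B\,d\omega$. (4) There exists a constant $C$ such that $K(K\omega)^q\le C\,K\omega<\infty$ $\sigma$-a.e.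
   Context: $X$ is a metric space and $\mathcal M_+(X)$ is the set of positive $\sigma$-finite Borel measures on $X$; $\sigma$ is the underlying measure. $|E|_\mu=\mu(E)$. $L^0_+(\sigma)$ is the set of ($\sigma$-a.e. classes of) Borel functions $X\to[0,\infty)$. A quasi-metric kernel is a Borel function $K:X\times X\to(0,\infty]$ that is symmetric and for which there is a constant $\kappa\ge1$ with $$\frac1{K(x,y)}\le\kappa\left(\frac1{K(x,z)}+\frac1{K(z,y)}\right)\quad\text{for all }x,y,z\in X.$$ Put $\rho(x,y)=1/K(x,y)$ ($\rho(x,x)>0$ is allowed) and $B_a(x)=\{y\in X:\rho(x,y)\le a\}$ (possibly empty). For $\mu\in\mathcal M_+(X)$, $K\mu(x)=\int_X K(x,y)\,d\mu(y)$; for a nonnegative Borel function $f$, $Kf(x)=\int_X K(x,y)f(y)\,d\sigma(y)$ (integration against $\sigma$). $\mathcal Z_{q,K}$ is the set of measurable $f$ for which there is $\epsilon>0$ such that $u=Ku^q+\epsilon|f|$ $\sigma$-a.e. has a solution $u\in L^0_+(\sigma)$. The usual convention $0\cdot\infty=0$ is used. *)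

(* Defs.v *)
From HB Require Import structures.
From mathcomp Require Import all_boot all_order all_algebra.
From mathcomp Require Import all_classical all_reals all_analysis.
From mathcomp Require Import measurable_realfun.

Set Implicit Arguments.
Unset Strict Implicit.
Unset Printing Implicit Defensive.

Import Order.TTheory GRing.Theory Num.Theory.
Import numFieldNormedType.Exports.

Local Open Scope classical_set_scope.
Local Open Scope ring_scope.

(* [measurableType] extends [pointedType], so the metric space is pointed. *)
#[short(type="pmetricType")]
HB.structure Definition PMetric (R : numDomainType) :=
  {T of Metric R T & Pointed T}.

Notation borelType X := (g_sigma_algebraType (@open X)).

(* On [X * X], "Borel" refers to the Borel sigma-algebra of the product
   topology; it contains the product of the Borel sigma-algebras, possibly
   strictly when [X] is not separable. *)
Definition quasi_metric_kernel (R : realType) (X : pmetricType R)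
    (K : X -> X -> \bar R) : Prop :=
  [/\ measurable_fun [set: borelType (X * X)%type]
        (fun z : borelType (X * X)%type => K z.1 z.2),
      forall x y, (0 < K x y)%E,
      forall x y, K x y = K y x &
      exists2 kappa : R, 1 <= kappa &
        forall x y z,
          ((K x y)^-1 <= kappa%:E * ((K x z)^-1 + (K z y)^-1))%E].

Section kernel_operators.
Context (R : realType) (X : pmetricType R) (K : X -> X -> \bar R).
Implicit Types mu sigma omega :
  {sigma_finite_measure set (borelType X) -> \bar R}.
Implicit Types (f : X -> \bar R) (B : set X) (p q a : R) (x : X).

Local Open Scope ereal_scope.

(* [rho = 1 / K] with [1 / +oo = 0]. *)
Definition rho (x y : X) : \bar R := (K x y)^-1.

Definition rho_ball x a : set (borelType X) := [set y | rho x y <= a%:E].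

Definition potential mu x : \bar R := \int[mu]_y K x y.

(* [K mu_B] for [d mu_B = chi_B d mu]. *)
Definition potential_in mu B x : \bar R := \int[mu]_(y in B) K x y.

Definition operator sigma f x : \bar R := \int[sigma]_y (K x y * f y).

Definition calZ sigma q f : Prop :=
  measurable_fun [set: borelType X] f /\
  exists2 eps : R, (0 < eps)%R &
  exists u : borelType X -> R,
    [/\ measurable_fun [set: borelType X] u,
        forall x, (0 <= u x)%R &
        {ae sigma, forall x, (u x)%:E =
          operator sigma (fun y => (u y)%:E `^ q) x + eps%:E * `|f x|}].

Definition infinitesimal_inequality sigma omega p q : Prop :=
  ereal_sup [set z | exists x a, (0 < a)%R /\ z =
    (\int[lebesgue_measure]_(t in `]0%R, a[)
        (sigma (rho_ball x t) * ((t ^+ 2)^-1)%:E)) *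
    (\int[lebesgue_measure]_(t in `]a, +oo[)
        (omega (rho_ball x t) * ((t ^+ 2)^-1)%:E)) `^ (q / p)] < +oo.

Definition weighted_norm_inequality sigma omega p : Prop :=
  exists C : R, forall g : borelType X -> R,
    g \in Lfun sigma p%:E -> (forall x, (0 <= g x)%R) ->
    \int[omega]_x (operator sigma (EFin \o g) x `^ p)
      <= C%:E * \int[sigma]_x ((g x)%:E `^ p).

Definition testing_inequality sigma omega q : Prop :=
  exists C : R, forall x a, (0 < a)%R ->
    let B := rho_ball x a in
    \int[sigma]_(z in B) (potential_in omega B z `^ q) <= C%:E * omega B.

End kernel_operators.

(* Main.v *)
Require Import Defs.
From mathcomp Require Import all_boot all_order all_algebra.
From mathcomp Require Import all_classical all_reals all_analysis.
From mathcomp Require Import measurable_realfun.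
From mathcomp Require Import ring lra.

Set Implicit Arguments.
Unset Strict Implicit.
Unset Printing Implicit Defensive.

Import Order.TTheory GRing.Theory Num.Theory.
Import numFieldNormedType.Exports.

Local Open Scope classical_set_scope.
Local Open Scope ring_scope.

(** Write [rho = 1 / K], [B_t(x)] for the balls of [rho], and

      [A_x(a)] = the integral over [0 < t < a] of [sigma(B_t(x)) dt / t^2],
      [W_x(a)] = the integral over [t > a] of [omega(B_t(x)) dt / t^2],

    so that [W_x(0) = K omega (x)] and the infinitesimal inequality says that
    [A_x(a) W_x(a)^(q-1)] is bounded ([q / p = q - 1]).  The four statements
    are proved equivalent around the cycle: solvability, norm inequality,
    testing inequality, pointwise supersolution inequality, solvability.

    Three facts about nonnegative integrals carry the argument.

    - Tail powers ([integral_tail_poweR]).  If [G(y)] is the integral of [k]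
      over [r >= r(y)], then [(int k)^(t+1) <= 2^(t+1) int k G^t]: the points
      where [G] is below half of the total mass carry at most half of the mass.
      With [r = rho(x, .)], and since [K(x,z) <= 2 kappa K(y,z)] when
      [rho(x,z) >= rho(x,y)], this gives [(K g)^(t+1) <= C K(g (K g)^t)]
      pointwise ([operator_poweR]).  With [r] the radius, it bounds [W^q] by
      the integral of [W^(q-1)] against [- dW] ([high_potential_poweR]).
    - Superlevel sets ([integral_superlevel_le]), the exhaustion argument
      behind the previous fact: if [k] has integral at most [M] over each set
      [S /\ (r >= r(y))] with [y] in [S], then also over [S].
    - Tonelli up to a constant ([tonelli_operator]).  As [X] may be
      nonseparable, [K] is Borel on [X * X] but possibly not measurable for the
      product of the Borel sigma-algebras, so that the order of integration in
      [int int h(x) K(x,y) g(y)] cannot be exchanged directly.  However, at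
      each scale [t] a maximal disjoint family of balls of positive measure is
      countable, and a countable covering yields the exchange for balls of
      radius [t] up to an enlargement of the radius ([tonelli_qball]);
      integrating over [t] gives the exchange for [K] with the constant
      [20 kappa^3].

    Solvability implies the norm inequality ([solution_norm]): let [T = K g].
    The tail powers and Tonelli give the Schur-type bound
    [int h T^p dnu <= C int g T^(p-1) K(h nu) dsigma].  For [h nu = u^q sigma],
    [K(u^q sigma) <= u] and Young's inequality bound the energy
    [int u^q T^p dsigma] by [C int g^p dsigma] plus half of itself.  Then
    [h nu = omega], [eps K omega <= u] and Young's inequality again bound
    [int T^p domega] by [int g^p dsigma] plus that energy.

    Solvability implies the infinitesimal inequality
    ([solution_infinitesimal]): on [B_a(x)] the solution is at least
    [w = eps W_x(a) / (2 kappa)]; on the shell where [2^k w <= u < 2^(k+1) w]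
    the superlevel argument and [K u^q <= u] bound the integral of
    [K(x, .) dsigma] by [4 kappa (2^k w)^(1-q)], and the sum over [k] is
    geometric because [q > 1].

    The norm inequality implies testing ([weighted_norm_testing]) by duality,
    with [g = (K omega_B)^(q-1)] on [B].  Testing implies the supersolution
    inequality ([testing_pointwise]): [K (K omega)^q (x)] is the integral over
    [t] of [int_(B_t(x)) (K omega)^q dsigma dt / t^2], and on [B_t(x)] the
    potential [K omega] is at most the potential of the part of [omega] in
    [B_(2 kappa t)(x)] plus [2 kappa W_x(t)]; the former is controlled by
    testing, the latter by the infinitesimal inequality.  Lastly, a
    supersolution [K f^q <= C f < oo] produces a solution by monotone iteration
    starting from [0] ([supersolution_calZ]). *)

(** * Powers and limits of extended nonnegative numbers *)

Section poweR_facts.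
Context (R : realType).
Implicit Types (x y : \bar R) (r : R).
Local Open Scope ereal_scope.

Lemma lee_poweR r x y : (0 <= r)%R -> 0 <= x -> x <= y -> x `^ r <= y `^ r.
Proof.
move=> r0 x0 xy; apply: gt0_ler_poweR => //; rewrite in_itv/= leey andbT//.
exact: le_trans xy.
Qed.

Lemma poweRD_le (a b : \bar R) r : (0 <= r)%R -> 0 <= a -> 0 <= b ->
  (a + b) `^ r <= 2%:E `^ r * (a `^ r + b `^ r).
Proof.
move=> r0; wlog ab : a b / a <= b.
  move=> H a0 b0; have [ab|/ltW ba] := leP a b; first exact: H.
  by rewrite addeC [X in _ * X]addeC; exact: H.
move=> a0 b0; apply: (@le_trans _ _ ((2%:E * b) `^ r)).
  apply: lee_poweR => //; first by rewrite adde_ge0.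
  by rewrite -[2%R]/(1 + 1)%R EFinD ge0_muleDl// mul1e leeD2r.
by rewrite poweRM// lee_wpmul2l ?poweR_ge0// leeDr// poweR_ge0.
Qed.

Lemma limn_poweR (a : nat -> \bar R) (r : R) : (0 < r)%R ->
  {homo a : n m / (n <= m)%N >-> n <= m} -> (forall n, 0 <= a n) ->
  limn (fun n => a n `^ r) = (limn a) `^ r.
Proof.
move=> r0 nda a0.
have ndr : {homo (fun n => a n `^ r) : n m / (n <= m)%N >-> n <= m}.
  by move=> n m nm; apply: lee_poweR => //; [exact: ltW|exact: nda].
have cva := ereal_nondecreasing_is_cvgn nda.
have cvr := ereal_nondecreasing_is_cvgn ndr.
have la n : a n <= limn a by apply: (lime_ge cva); near=> m; apply: nda; near: m; exact: nbhs_infty_ge.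
have lr n : a n `^ r <= limn (fun n => a n `^ r).
  by apply: (lime_ge cvr); near=> m; apply: ndr; near: m; exact: nbhs_infty_ge.
apply/eqP; rewrite eq_le; apply/andP; split.
  by apply: (lime_le cvr); apply: nearW => n; apply: lee_poweR => //; exact: ltW.
set s := limn _ in lr *.
have s0 : 0 <= s by apply: le_trans (lr 0%N); exact: poweR_ge0.
have -> : s = (s `^ r^-1) `^ r by rewrite -poweRrM mulVf ?gt_eqF// poweRe1.
apply: lee_poweR; [exact: ltW|exact: le_trans (a0 0%N) (la 0%N)|].
apply: (lime_le cva); apply: nearW => n.
rewrite -[a n](poweRe1 (a0 n)) -(@mulfV _ r) ?gt_eqF// poweRrM.
by apply: lee_poweR => //; [rewrite invr_ge0 ltW|exact: poweR_ge0].
Unshelve. all: by end_near. Qed.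

Lemma limn_ge0_muleZ (k : \bar R) (a : nat -> \bar R) : 0 <= k ->
  {homo a : n m / (n <= m)%N >-> n <= m} -> (forall n, 0 <= a n) ->
  limn (fun n => k * a n) = k * limn a.
Proof.
move=> k0 nda a0; have cva := ereal_nondecreasing_is_cvgn nda.
have la n : a n <= limn a.
  by apply: (lime_ge cva); near=> m; apply: nda; near: m; exact: nbhs_infty_ge.
have ndk : {homo (fun n => k * a n) : n m / (n <= m)%N >-> n <= m}.
  by move=> n m nm; rewrite lee_wpmul2l// nda.
have cvk := ereal_nondecreasing_is_cvgn ndk.
have lk n : k * a n <= limn (fun n => k * a n).
  by apply: (lime_ge cvk); near=> m; apply: ndk; near: m; exact: nbhs_infty_ge.
apply/eqP; rewrite eq_le; apply/andP; split.
  by apply: (lime_le cvk); apply: nearW => n; exact: lee_wpmul2l.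
set s := limn _ in lk *.
have s0 : 0 <= s by apply: le_trans (lk 0%N); rewrite mule_ge0.
case: k k0 ndk cvk @s lk s0 => [k| |]// k0 ndk cvk s lk s0.
  have [<-|{}k0] : (0 = k)%R \/ (0 < k)%R.
    by move: k0; rewrite lee_fin le_eqVlt => /predU1P.
    by rewrite mul0e.
  rewrite muleC -lee_pdivlMr//; apply: (lime_le cva); apply: nearW => n.
  by rewrite lee_pdivlMr// muleC.
have [->|/eqP l0] := eqVneq (limn a) 0; first by rewrite mule0.
suff -> : s = +oo by rewrite leey.
have [n an] : exists n, 0 < a n.
  apply/not_existsP => H; apply: l0; apply/eqP; rewrite eq_le.
  rewrite (le_trans (a0 0%N) (la 0%N)) andbT; apply: (lime_le cva); apply: nearW => n.
  by rewrite leNgt; apply/negP/H.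
by apply/eqP; rewrite -leye_eq; apply: le_trans (lk n); rewrite gt0_mulye.
Unshelve. all: by end_near. Qed.

Lemma inve_fin_ge0 (s : R) : (0 <= s)%R -> 0 <= (s%:E)^-1.
Proof. by move=> s0; rewrite inver; case: ifPn => // _; rewrite lee_fin invr_ge0. Qed.

Lemma lee_inve_scale (c a b : R) : (0 < c)%R -> (0 <= a)%R ->
  (a <= c * b)%R -> (b%:E)^-1 <= c%:E * (a%:E)^-1.
Proof.
move=> c0; rewrite le_eqVlt => /predU1P[<- _|a0 ab].
  by rewrite inve0 gt0_muley ?lte_fin// leey.
have b0 : (0 < b)%R by rewrite -(pmulr_rgt0 _ c0) (lt_le_trans a0).
by rewrite !inver !gt_eqF// -EFinM lee_fin ler_pdivlMr// ler_pdivrMl// mulrC.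
Qed.

Lemma nneseries_geometric_le (b r : R) : (0 <= b)%R -> (0 < r)%R -> (r < 1)%R ->
  \sum_(k <oo) (b * r ^+ k)%:E <= (b / (1 - r))%:E.
Proof.
move=> b0 r0 r1; apply: lime_le.
  by apply: is_cvg_nneseries => k _ _; rewrite lee_fin mulr_ge0// exprn_ge0// ltW.
apply: nearW => n; rewrite sumEFin lee_fin -mulr_sumr ler_wpM2l//.
rewrite -[leRHS]mul1r ler_pdivlMr ?subr_gt0// big_mkord mulrC -opprB mulNr -subrX1 opprB.
by rewrite gerBl exprn_ge0// ltW.
Qed.

End poweR_facts.

(** * Conjugate exponents and Young's inequality *)
Section conjugate_exponents.
Context (R : realType) (p q : R).
Hypothesis q1 : (1 < q)%R.
Hypothesis pq : (p^-1 + q^-1 = 1)%R.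
Local Open Scope ereal_scope.

Lemma conj_exponent : (q / p = q - 1)%R.
Proof.
have q0 : q != 0%R by rewrite gt_eqF// (lt_trans ltr01).
have -> : (p^-1 = 1 - q^-1)%R by rewrite -pq addrK.
by rewrite mulrBr mulr1 divff.
Qed.

Lemma p_gt1 : (1 < p)%R.
Proof.
have q0 : (0 < q)%R by rewrite (lt_trans ltr01).
have pE : (p^-1 = 1 - q^-1)%R by rewrite -pq addrK.
have p0 : (0 < p^-1)%R by rewrite pE subr_gt0 invf_lt1.
have p1 : (p^-1 < 1)%R by rewrite pE gtrBl invr_gt0.
by rewrite -[p]invrK invf_gt1.
Qed.

Lemma mul_conj_exponent : ((q - 1) * p = q)%R.
Proof.
have p0 : p != 0%R by rewrite gt_eqF// (lt_trans ltr01)// p_gt1.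
by rewrite -conj_exponent mulfVK.
Qed.

Lemma mul_conj_exponentC : ((p - 1) * q = p)%R.
Proof.
have q0 : q != 0%R by rewrite gt_eqF// (lt_trans ltr01).
have p0 : p != 0%R by rewrite gt_eqF// (lt_trans ltr01)// p_gt1.
have : (p * q = q + p)%R by rewrite -[LHS]mulr1 -pq; field; rewrite q0.
by rewrite mulrBl mul1r => ->; rewrite addrAC subrr add0r.
Qed.

(** The free weight [d] lets one of the two terms be made small enough to be
    absorbed; both terms may be infinite. *)
Lemma lee_mul_Young (a b : \bar R) (d : R) : (0 < d)%R -> 0 <= a -> 0 <= b ->
  a * b <= (d `^ p)%:E * a `^ p + (d `^ (- q))%:E * b `^ q.
Proof.
have p1 := p_gt1; have p0 : (0 < p)%R by exact: lt_trans p1.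
have q0 : (0 < q)%R by exact: lt_trans q1.
move=> d0 a0 b0.
have A0 : 0 <= (d `^ p)%:E * a `^ p by rewrite mule_ge0 ?poweR_ge0// lee_fin powR_ge0.
have B0 : 0 <= (d `^ (- q))%:E * b `^ q by rewrite mule_ge0 ?poweR_ge0// lee_fin powR_ge0.
have dp : 0 < (d `^ p)%:E by rewrite lte_fin powR_gt0.
have dq : 0 < (d `^ (- q))%:E by rewrite lte_fin powR_gt0.
case: a a0 A0 => [a| |]// a0 A0; last first.
  rewrite (poweRyr (lt0r_neq0 p0)) (gt0_muley dp) addye ?leey//.
  by rewrite gt_eqF// (lt_le_trans _ B0)// ltNy0.
case: b b0 B0 => [b| |]// b0 B0; last first.
  rewrite (poweRyr (lt0r_neq0 q0)) (gt0_muley dq) addey ?leey//.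
move: a0 b0; rewrite !lee_fin => a0 b0.
have da : (0 <= d * a)%R by rewrite mulr_ge0// ltW.
have db : (0 <= d^-1 * b)%R by rewrite mulr_ge0// invr_ge0 ltW.
have -> : (a * b = (d * a) * (d^-1 * b))%R.
  by rewrite mulrACA divff ?mul1r// gt_eqF.
apply: (le_trans (conjugate_powR da db p0 q0 pq)).
rewrite !powRM ?invr_ge0 ?(ltW d0)// -(powR_inv1 (ltW d0)) -powRrM mulN1r.
apply: lerD.
  by rewrite ler_piMr ?mulr_ge0 ?powR_ge0// invf_le1// ltW.
by rewrite ler_piMr ?mulr_ge0 ?powR_ge0// invf_le1// ltW.
Qed.

End conjugate_exponents.

(** * Integrals of nonnegative functions *)
Section integral_nonneg.
Context d (T : measurableType d) (R : realType).
Variable mu : {measure set T -> \bar R}.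
Implicit Types (f g k : T -> \bar R) (A B D S : set T).

Local Open Scope ereal_scope.

Lemma ae_imp (P Q : T -> Prop) : (forall x, P x -> Q x) ->
  {ae mu, forall x, P x} -> {ae mu, forall x, Q x}.
Proof. by move=> PQ; apply: filterS. Qed.

Lemma ae_imp2 (P Q S : T -> Prop) : (forall x, P x -> Q x -> S x) ->
  {ae mu, forall x, P x} -> {ae mu, forall x, Q x} -> {ae mu, forall x, S x}.
Proof. by move=> PQ; apply: filterS2. Qed.

(** Compares the suprema over simple functions that define both integrals. *)
Lemma ge0_integral_mono D f g : (forall x, D x -> 0 <= f x) ->
  (forall x, D x -> f x <= g x) ->
  \int[mu]_(x in D) f x <= \int[mu]_(x in D) g x.
Proof.
move=> f0 fg; rewrite !(integral_mkcond D).
rewrite !ge0_integralTE; last 2 first.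
- by apply: erestrict_ge0 => x Dx; exact: le_trans (f0 _ Dx) (fg _ Dx).
- exact: erestrict_ge0.
apply: le_ereal_sup => _ [h hf <-]; exists h => // x.
by apply: le_trans (hf x) _; rewrite /patch; case: ifPn => // /set_mem; exact: fg.
Qed.

Lemma ge0_integral_subset A B f g : A `<=` B -> (forall x, B x -> 0 <= g x) ->
  (forall x, A x -> 0 <= f x <= g x) ->
  \int[mu]_(x in A) f x <= \int[mu]_(x in B) g x.
Proof.
move=> AB g0 fg; rewrite (integral_mkcond A) (integral_mkcond B).
have f0 x : 0 <= (f \_ A) x by apply: erestrict_ge0 => y /fg /andP[].
apply: ge0_integral_mono => x _ //; rewrite !patchE.
case: ifPn => [/set_mem Ax|_]; first by rewrite mem_set; [case/andP: (fg _ Ax)|exact: AB].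
by case: ifPn => // /set_mem /g0.
Qed.

Lemma integral_set_bool (b : T -> bool) f :
  \int[mu]_(x in [set x | b x]) f x = \int[mu]_x (((b x)%:R)%:E * f x).
Proof.
rewrite integral_mkcond; apply: eq_integral => x _; rewrite patchE.
have -> : (x \in [set x | b x]) = b x by apply/idP/idP; rewrite inE.
by case: (b x); rewrite ?mul1e ?mul0e.
Qed.

Lemma integral_bigcup_le (F : (set T)^nat) f (M : \bar R) :
  {homo F : n m / (n <= m)%N >-> n `<=` m} ->
  (forall n, measurable (F n)) -> measurable_fun setT f ->
  (forall x, 0 <= f x) ->
  (forall n, \int[mu]_(x in F n) f x <= M) ->
  \int[mu]_(x in \bigcup_n F n) f x <= M.
Proof.
move=> ndF mF mf f0 FM.
have cvF : \int[mu]_(x in F i) f x @[i --> \oo] -->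
    \int[mu]_(x in \bigcup_i F i) f x.
  apply: ge0_nondecreasing_set_cvg_integral => //.
  - by move=> n m nm; apply/subsetPset; exact: ndF.
  - by move=> i; exact: measurable_funTS.
rewrite -(cvg_lim _ cvF)//; apply: lime_le; first by apply/cvg_ex; eexists; exact: cvF.
by apply: nearW.
Qed.

(** If [r] attains its infimum on [S] at some [y], then [S] is one of the pieces
    of the hypothesis.  Otherwise [S] is the increasing union of the sets
    [S /\ (r >= inf r + 1 / (n+1))], each contained in one of those pieces. *)
Lemma integral_superlevel_le (r : T -> R) k S (M : \bar R) :
  measurable S -> measurable_fun setT r -> measurable_fun setT k ->
  (forall x, (0 <= r x)%R) -> (forall x, 0 <= k x) -> 0 <= M ->
  (forall y, S y -> \int[mu]_(z in S `&` [set z | (r y <= r z)%R]) k z <= M) ->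
  \int[mu]_(z in S) k z <= M.
Proof.
move=> mS mr mk r0 k0 M0 H.
have mge (c : R) : measurable [set z | (c <= r z)%R].
  rewrite -[X in measurable X]setTI -preimage_itvcy.
  exact: mr.
have [[y Sy ymin]|nomin] := pselect (exists2 y, S y & forall z, S z -> (r y <= r z)%R).
  rewrite (_ : S = S `&` [set z | (r y <= r z)%R]); first exact: H.
  by apply/seteqP; split => [z Sz|z []//]; split => //; exact: ymin.
have [->|S0] := eqVneq S set0; first by rewrite integral_set0.
pose r_inf := inf (r @` S).
have hi : has_inf (r @` S).
  split; first by move/set0P : S0 => [x Sx]; exists (r x), x.
  by exists 0%R => _ [z _ <-].
pose F n := S `&` [set z | (r_inf + n.+1%:R^-1 <= r z)%R].
have SF : S = \bigcup_n F n.
  apply/seteqP; split => [z Sz|z [n _ []]//].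
  have rz : (r_inf < r z)%R.
    rewrite lt_neqAle (ge_inf hi.2) ?andbT; last by exists z.
    apply/eqP => e; apply: nomin; exists z => // w Sw; rewrite -e.
    by apply: ge_inf hi.2 _ _; exists w.
  pose n := Num.truncn ((r z - r_inf)^-1).
  exists n => //; split => //=.
  rewrite -lerBrDl -[leRHS]invrK lef_pV2 ?posrE ?invr_gt0 ?subr_gt0 ?ltr0n//.
  by apply/ltW/truncnS_gt.
rewrite SF; apply: integral_bigcup_le => //.
- move=> n m nm z [Sz /= h]; split => //=; apply: le_trans h.
  by rewrite lerD2l lef_pV2 ?posrE ?ltr0n// ler_nat ltnS.
- by move=> n; exact: measurableI.
move=> n.
have [_ [y Sy <-] ry] : exists2 y, (r @` S) y & (y < r_inf + n.+1%:R^-1)%R.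
  by apply: inf_adherent => //; rewrite invr_gt0 ltr0n.
apply: le_trans (H y Sy); apply: ge0_subset_integral => //.
- exact: measurableI.
- exact: measurableI.
- exact: measurable_funTS.
by move=> z [Sz /= h]; split => //=; apply: le_trans h; exact: ltW.
Qed.

Lemma integral_limn_poweR_le (D : set T) (a : nat -> T -> \bar R) (r : R) (M : \bar R) :
  (0 < r)%R -> measurable D -> (forall n, measurable_fun setT (a n)) ->
  (forall n x, 0 <= a n x) ->
  (forall x, {homo a ^~ x : n m / (n <= m)%N >-> n <= m}) ->
  (forall n, \int[mu]_(x in D) (a n x `^ r) <= M) ->
  \int[mu]_(x in D) ((limn (a ^~ x)) `^ r) <= M.
Proof.
move=> r0 mD ma a0 nda H.
have ndr x : {homo (fun n => a n x `^ r) : n m / (n <= m)%N >-> n <= m}.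
  by move=> n m nm; apply: lee_poweR => //; [exact: ltW|exact: nda].
have mar n : measurable_fun D (fun x : T => a n x `^ r).
  by apply: measurable_funTS; exact: (measurableT_comp (measurable_poweR r)).
have cv := @cvg_monotone_convergence _ T R mu D mD (fun n (x : T) => a n x `^ r) mar
  (fun n x _ => poweR_ge0 _ _) (fun x _ => ndr x).
have -> : \int[mu]_(x in D) ((limn (a ^~ x)) `^ r) =
    \int[mu]_(x in D) limn (fun n => a n x `^ r).
  by apply: eq_integral => x _; rewrite limn_poweR.
rewrite -(cvg_lim _ cv)//; apply: lime_le; last exact: nearW.
by apply/cvg_ex; eexists; exact: cv.
Qed.

Lemma integral_truncate_le (D : set T) (f : T -> \bar R) (r : R) (M : \bar R) :
  (0 < r)%R -> measurable D -> measurable_fun setT f -> (forall x, 0 <= f x) ->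
  (forall n : nat, \int[mu]_(x in D) (Order.min (f x) n%:R%:E `^ r) <= M) ->
  \int[mu]_(x in D) (f x `^ r) <= M.
Proof.
move=> r0 mD mf f0 H.
pose a x (n : nat) := Order.min (f x) n%:R%:E.
have a0 x n : 0 <= a x n by rewrite le_min f0 lee_fin ler0n.
have nda x : {homo a x : n m / (n <= m)%N >-> n <= m}.
  by move=> n m nm; rewrite le_min !ge_min lexx/= lee_fin ler_nat nm orbT.
have lima x : limn (a x) = f x.
  have cva := ereal_nondecreasing_is_cvgn (nda x).
  apply/eqP; rewrite eq_le; apply/andP; split.
    by apply: (lime_le cva); apply: nearW => n; rewrite ge_min lexx.
  have ge (A : R) : A%:E <= f x -> A%:E <= limn (a x).
    move=> Af; apply: (lime_ge cva); near=> n; rewrite le_min Af lee_fin/=.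
    by near: n; exact: nbhs_infty_ger.
  have := f0 x; case: (f x) ge => [u| |] ge// _; first by rewrite ge.
  by rewrite leye_eq; apply/eqP/eqyP => A _; rewrite ge ?leey.
have -> : \int[mu]_(x in D) (f x `^ r) = \int[mu]_(x in D) ((limn (a x)) `^ r).
  by apply: eq_integral => x _; rewrite lima.
apply: (integral_limn_poweR_le (a := fun n x => a x n)) => // n.
by apply: measurable_mine => //; exact: measurable_cst.
Unshelve. all: by end_near. Qed.

End integral_nonneg.

(** * Power of an integral versus the integrals over its tails *)
Section tail.
Context d (T : measurableType d) (R : realType).
Variable mu : {measure set T -> \bar R}.
Implicit Types (k : T -> \bar R) (S : set T).
Local Open Scope ereal_scope.

(** Let [N = int_S k], let [G(y)] be the tail integral and [M <= N / 2].  The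
    set where [G < M] has [k]-mass at most [M], by [integral_superlevel_le], so
    that mass at least [M] remains where [G >= M], and [int_S k G^t >= M^(t+1)].
    It remains to take [M = N / 2], or [M] arbitrarily large if [N] is
    infinite. *)
Lemma integral_tail_poweR (r : T -> R) k S (t : R) :
  measurable S -> measurable_fun setT r -> measurable_fun setT k ->
  (forall x, (0 <= r x)%R) -> (forall x, 0 <= k x) -> (0 <= t)%R ->
  (\int[mu]_(z in S) k z) `^ (t + 1) <=
  2%:E `^ (t + 1) *
  \int[mu]_(y in S)
    (k y * (\int[mu]_(z in S `&` [set z | (r y <= r z)%R]) k z) `^ t).
Proof.
move=> mS mr mk r0 k0 t0.
have t1 : (0 < t + 1)%R by rewrite ltr_wpDl.
set G := fun y => \int[mu]_(z in S `&` [set z | (r y <= r z)%R]) k z.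
set N := \int[mu]_(z in S) k z; set I := \int[mu]_(y in S) _.
have N0 : 0 <= N by exact: integral_ge0.
have G0 y : 0 <= G y by exact: integral_ge0.
have I0 : 0 <= I by apply: integral_ge0 => y _; rewrite mule_ge0 ?poweR_ge0.
have mge (c : R) : measurable [set z | (c <= r z)%R].
  rewrite -[X in measurable X]setTI -preimage_itvcy.
  exact: mr.
have claim (M : R) : (0 <= M)%R -> (2 * M)%:E <= N -> M%:E `^ (t + 1) <= I.
  rewrite le_eqVlt => /predU1P[<- _|M0 MN].
    by rewrite poweR0r ?gt_eqF.
  pose U := [set c : R | \int[mu]_(z in S `&` [set z | (c <= r z)%R]) k z < M%:E].
  have mU : measurable U.
    apply: is_interval_measurable => a b Ua Ub c /andP[ac cb].
    apply: le_lt_trans Ua; apply: ge0_subset_integral => //.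
    - exact: measurableI.
    - exact: measurableI.
    - exact: measurable_funTS.
    - by move=> z [Sz /= cz]; split => //=; exact: le_trans ac cz.
  pose B := S `&` (r @^-1` U).
  have mB : measurable B.
    by apply: measurableI => //; rewrite -[X in measurable X]setTI; exact: mr.
  have BM : \int[mu]_(z in B) k z <= M%:E.
    apply: (@integral_superlevel_le _ _ _ _ r) => //; first by rewrite lee_fin ltW.
    move=> y [Sy Uy]; apply: le_trans (ltW Uy).
    apply: ge0_subset_integral => //.
    - exact: measurableI.
    - exact: measurableI.
    - exact: measurable_funTS.
    - by move=> z [[Sz _] h].
  have SE : N = \int[mu]_(z in B) k z + \int[mu]_(z in S `\` B) k z.
    rewrite /N -[in LHS](setDUK (_ : B `<=` S)); last by move=> z [].
    rewrite ge0_integral_setU//.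
    - exact: measurableD.
    - exact: measurable_funTS.
    - by rewrite disj_set2E setDIK.
  have gM : M%:E <= \int[mu]_(z in S `\` B) k z.
    rewrite leNgt; apply/negP => h.
    have : N < M%:E + M%:E by rewrite SE (le_lt_trans (leeD2r _ BM))// lteD2lE.
    rewrite ltNge => /negP; apply.
    by apply: le_trans MN; rewrite -EFinD lee_fin mulr_natl mulr2n.
  have -> : M%:E `^ (t + 1) = M%:E `^ t * M%:E.
    by rewrite !poweR_EFin -EFinM powRD ?powRr1 ?(ltW M0)//; apply/implyP; rewrite gt_eqF.
  apply: (@le_trans _ _ (M%:E `^ t * \int[mu]_(z in S `\` B) k z)).
    by rewrite lee_wpmul2l ?poweR_ge0.
  rewrite -ge0_integralZl ?poweR_ge0//; last 2 first.
  - exact: measurableD.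
  - exact: measurable_funTS.
  apply: (@le_trans _ _ (\int[mu]_(y in S `\` B) (k y * G y `^ t))).
    apply: ge0_integral_mono => [y _|y [Sy By]].
      by rewrite mule_ge0 ?poweR_ge0.
    rewrite muleC lee_wpmul2l// lee_poweR ?lee_fin ?(ltW M0)//.
    by rewrite leNgt; apply/negP => h; apply: By; split.
  apply: ge0_integral_subset => [y []//|y _|y _].
    by rewrite mule_ge0 ?poweR_ge0.
  by rewrite lexx andbT mule_ge0 ?poweR_ge0.
have [Nfin|] := boolP (N \is a fin_num).
  have -> : N = 2%:E * (fine N / 2)%:E.
    by rewrite -EFinM mulrCA divff// mulr1 fineK.
  rewrite poweRM ?lee_fin ?divr_ge0 ?fine_ge0//.
  rewrite lee_wpmul2l ?poweR_ge0// claim ?divr_ge0 ?fine_ge0//.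
  by rewrite mulrCA divff// mulr1 fineK.
rewrite ge0_fin_numE// -leNgt leye_eq => /eqP Ny.
suff -> : I = +oo by rewrite gt0_muley ?leey// poweR_gt0.
apply/eqyP => A A0.
have := claim _ (powR_ge0 A (t + 1)^-1).
rewrite poweR_EFin -powRrM mulVf ?gt_eqF// powRr1 ?(ltW A0)//.
by apply; rewrite Ny leey.
Qed.

End tail.

(** * Layer-cake formula with respect to dt / t^2 *)
Section layer_cake.
Context (R : realType).
Local Open Scope ereal_scope.
Local Notation leb := (@lebesgue_measure R).

Definition invsq (t : R) : \bar R := ((t ^+ 2)^-1)%:E.

Lemma invsq_ge0 t : 0 <= invsq t.
Proof. by rewrite lee_fin invr_ge0 sqr_ge0. Qed.

Lemma measurable_fun_invr_ge0 d (T : measurableType d) (f : T -> R) :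
  (forall x, (0 <= f x)%R) -> measurable_fun setT f ->
  measurable_fun setT (fun x => (f x)^-1%R).
Proof.
move=> f0 mf; rewrite (_ : (fun _ => _) = (fun x => f x `^ (-1))%R).
  exact: (measurableT_comp (measurable_powR (-1)) mf).
by apply/funext => x; rewrite powR_inv1.
Qed.

Lemma measurable_invsq : measurable_fun setT invsq.
Proof.
apply/measurable_EFinP; apply: measurable_fun_invr_ge0; first by move=> t; exact: sqr_ge0.
exact: measurable_funX.
Qed.

Lemma integral_invsq (m : R) : (0 < m)%R ->
  \int[leb]_(t in `]m, +oo[) invsq t = (m^-1)%:E.
Proof.
move=> m0; rewrite integral_itv_obnd_cbnd; last first.
  by apply: measurable_funTS; exact: measurable_invsq.
rewrite (@ge0_continuous_FTC2y _ _ (fun t => - t^-1)%R _ 0%R) ?EFinN ?sub0e ?oppeK//.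
- by move=> t _; rewrite invr_ge0 sqr_ge0.
- apply: continuous_in_subspaceT => t; rewrite inE/= in_itv/= andbT => mt.
  apply: cvgV; first by rewrite expf_neq0// gt_eqF// (lt_le_trans m0).
  exact: exprn_continuous.
- rewrite -oppr0; apply: cvgN.
  by apply/(@gtr0_cvgV0 _ R (pinfty_nbhs R) _ id); [exact: nbhs_pinfty_gt|exact: cvg_id].
- move=> t mt; apply: derivableN; apply: derivableV => //.
  by rewrite gt_eqF// (lt_trans m0).
- apply: cvgN; apply: cvg_at_right_filter; apply: cvgV => //.
  by rewrite gt_eqF.
- move=> t; rewrite in_itv/= andbT => mt.
  have t0 : t != 0%R by rewrite gt_eqF// (lt_trans m0).
  have D : is_derive t 1%R (fun t : R => - t^-1)%R (- (- t ^- 2 *: 1))%R.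
    by apply: is_deriveN; apply: is_deriveV.
  by rewrite derive1E (@derive_val _ _ _ _ _ _ _ D) scaleNr opprK /GRing.scale/= mulr1.
Qed.

Lemma measurable_ler_nat d (T : measurableType d) (u v : T -> R) :
  measurable_fun setT u -> measurable_fun setT v ->
  measurable_fun setT (fun z => ((u z <= v z)%R%:R)%:E : \bar R).
Proof.
move=> mu mv; apply/measurable_EFinP.
rewrite (_ : (fun _ => _) = \1_[set z | (u z <= v z)%R]).
  apply: measurable_indic; rewrite -[X in measurable X]setTI.
  exact: measurable_fun_le.
by apply/funext => z; rewrite indicE mem_setE.
Qed.

Lemma measurable_ltr_nat d (T : measurableType d) (u v : T -> R) :
  measurable_fun setT u -> measurable_fun setT v ->
  measurable_fun setT (fun z => ((u z < v z)%R%:R)%:E : \bar R).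
Proof.
move=> mu mv.
rewrite (_ : (fun _ => _) = fun z => (1 - (v z <= u z)%R%:R)%:E); last first.
  by apply/funext => z; rewrite ltNge; case: (v z <= u z)%R; rewrite /= ?subrr ?subr0.
apply/measurable_EFinP; apply: measurable_funB => //.
by apply/measurable_EFinP; exact: measurable_ler_nat.
Qed.

Lemma integral_invsq_max (b s : R) : (0 <= b)%R -> (0 <= s)%R ->
  \int[leb]_(t in `]b, +oo[) (((s <= t)%R%:R)%:E * invsq t) =
  ((Num.max b s)%:E)^-1.
Proof.
move=> b0 s0.
have f0 c t : 0 <= ((c <= t)%R%:R)%:E * invsq t.
  by rewrite mule_ge0 ?invsq_ge0// lee_fin ler0n.
have mf c : measurable_fun setT (fun t : R => ((c <= t)%R%:R)%:E * invsq t).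
  apply: emeasurable_funM; last exact: measurable_invsq.
  exact: measurable_ler_nat.
have pos m : (0 < m)%R -> (b <= m)%R -> (s <= m)%R ->
    (m^-1)%:E <= \int[leb]_(t in `]b, +oo[) (((s <= t)%R%:R)%:E * invsq t).
  move=> m0 bm sm; rewrite -integral_invsq//; apply: ge0_integral_subset => //.
    by move=> t /=; rewrite !in_itv/= !andbT; exact: le_lt_trans.
  move=> t /=; rewrite in_itv/= andbT => mt; rewrite invsq_ge0/=.
  by rewrite (le_trans sm (ltW mt)) mul1e.
have m0 : (0 <= Num.max b s)%R by rewrite le_max b0.
move: m0; rewrite le_eqVlt => /predU1P[m0|m0].
  rewrite -m0 inve0; apply/eqyP => A A0.
  apply: le_trans (pos A^-1%R _ _ _); rewrite ?invrK// ?invr_gt0//.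
  - by rewrite (@le_trans _ _ (Num.max b s))// ?le_max ?lexx// -m0 invr_ge0 ltW.
  - by rewrite (@le_trans _ _ (Num.max b s))// ?le_max ?lexx ?orbT// -m0 invr_ge0 ltW.
rewrite inver gt_eqF//; apply/eqP; rewrite eq_le; apply/andP; split; last first.
  by apply: pos => //; rewrite le_max lexx ?orbT.
rewrite -integral_invsq//.
rewrite integral_itv_obnd_cbnd; last exact: measurable_funTS.
rewrite [leRHS]integral_itv_obnd_cbnd; last by apply: measurable_funTS; exact: measurable_invsq.
rewrite integral_mkcond [leRHS]integral_mkcond.
apply: ge0_integral_mono => t _; rewrite !patchE; first by case: ifPn.
rewrite !mem_setE !in_itv/= !andbT ge_max.
by case: (b <= t)%R => //=; case: (s <= t)%R; rewrite ?mul1e ?mul0e.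
Qed.

Lemma integral_itvoy (a : R) (f : R -> \bar R) :
  \int[leb]_(t in `]a, +oo[) f t = \int[leb]_t (((a < t)%R%:R)%:E * f t).
Proof.
rewrite -integral_set_bool; congr (integral _ _ _).
by apply/seteqP; split => t /=; rewrite in_itv/= andbT.
Qed.

Lemma measurable_nondecreasing (f : R -> \bar R) :
  {homo f : s t / (s <= t)%R >-> s <= t} -> measurable_fun setT f.
Proof.
move=> ndf; apply: (measurability _ (ErealGenOInfty.measurableE R)).
move=> /= _ [_ [a ->]] <-; rewrite setTI preimage_itvoy.
apply: is_interval_measurable => s t /= fs _ u /andP[su _] /=.
exact: lt_le_trans fs (ndf _ _ su).
Qed.

Lemma measurable_nonincreasing (f : R -> \bar R) :
  {homo f : s t / (s <= t)%R >-> t <= s} -> measurable_fun setT f.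
Proof.
move=> ndf; apply: (measurability _ (ErealGenOInfty.measurableE R)).
move=> /= _ [_ [a ->]] <-; rewrite setTI preimage_itvoy.
apply: is_interval_measurable => s t /= _ ft u /andP[_ ut] /=.
exact: lt_le_trans ft (ndf _ _ ut).
Qed.

(** For fixed [y] the integral of [dt / t^2] over [t > b], [t >= s y] is
    [1 / max(b, s y)]; Tonelli applies since [s] and [h] depend on [y] only. *)
Lemma layer_cake d (T : measurableType d)
    (mu : {sigma_finite_measure set T -> \bar R}) (s : T -> R)
    (h : T -> \bar R) (b : R) :
  measurable_fun setT s -> measurable_fun setT h ->
  (forall y, (0 <= s y)%R) -> (forall y, 0 <= h y) -> (0 <= b)%R ->
  \int[leb]_(t in `]b, +oo[)
     ((\int[mu]_(y in [set y | (s y <= t)%R]) h y) * invsq t) =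
  \int[mu]_y (h y * ((Num.max b (s y))%:E)^-1).
Proof.
move=> ms mh s0 h0 b0.
pose F (z : T * R) := h z.1 * ((b < z.2)%R%:R%:E * (((s z.1 <= z.2)%R%:R)%:E * invsq z.2)).
have F0 z : 0 <= F z by rewrite /F !mule_ge0 ?invsq_ge0 ?lee_fin ?ler0n.
have mF : measurable_fun setT F.
  apply: emeasurable_funM; first exact: measurableT_comp mh measurable_fst.
  apply: emeasurable_funM; first by apply: measurable_ltr_nat => //; exact: measurable_snd.
  apply: emeasurable_funM; last exact: measurableT_comp measurable_invsq measurable_snd.
  by apply: measurable_ler_nat; [exact: measurableT_comp ms measurable_fst|exact: measurable_snd].
transitivity (\int[leb]_t \int[mu]_y F (y, t)).
  rewrite integral_mkcond; apply: eq_integral => t _; rewrite patchE.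
  rewrite mem_setE in_itv/= andbT /F/=; case: ifPn => bt; last first.
    by rewrite integral0_eq// => y _; rewrite mul0e mule0.
  rewrite muleC -ge0_integralZl ?invsq_ge0//; last 2 first.
  - rewrite -[X in measurable X]setTI; exact: measurable_fun_le.
  - exact: measurable_funTS.
  rewrite integral_set_bool; apply: eq_integral => y _.
  by rewrite mul1e (muleC (h y)) -muleA.
rewrite -fubini_tonelli//; apply: eq_integral => y _; rewrite /F/=.
rewrite ge0_integralZl//; last first.
- by move=> t _; rewrite !mule_ge0 ?invsq_ge0 ?lee_fin ?ler0n.
- apply: emeasurable_funM; first exact: measurable_ltr_nat.
  by apply: emeasurable_funM; [exact: measurable_ler_nat|exact: measurable_invsq].
congr (_ * _); rewrite -integral_invsq_max// [RHS]integral_mkcond.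
apply: eq_integral => t _; rewrite patchE mem_setE in_itv/= andbT.
by case: (b < t)%R; rewrite ?mul1e ?mul0e.
Qed.

End layer_cake.

Lemma measurable_fun_g_sigma d (T : measurableType d) (V : pointedType)
    (G : set (set V)) (f : T -> g_sigma_algebraType G) :
  (forall B, G B -> measurable (f @^-1` B)) -> measurable_fun setT f.
Proof.
move=> fG; apply: (@measurability _ _ T (g_sigma_algebraType G) setT f G) => //.
by move=> _ [B GB <-]; rewrite setTI; exact: fG.
Qed.

Lemma open_from_nbhs (T : topologicalType) (A : set T) :
  (forall x, A x -> nbhs x A) -> open A.
Proof. by rewrite openE. Qed.

(** * Sections of Borel sets of a product space *)
Section borel_sections.
Context (R : realType) (X : pmetricType R).
Local Notation BX := (borelType X).
Local Notation BXX := (borelType (X * X)%type).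
Local Open Scope ereal_scope.

Lemma measurable_pair_snd (x : X) :
  measurable_fun setT ((fun y => (x, y)) : BX -> BXX).
Proof.
apply: measurable_fun_g_sigma => B oB; apply: sub_sigma_algebra.
apply: (@open_comp X (X * X)%type (fun y => (x, y))) => // y _.
by apply: cvg_pair; [exact: cvg_cst|exact: cvg_id].
Qed.

Lemma measurable_borel_snd : measurable_fun setT (snd : BXX -> BX).
Proof.
apply: measurable_fun_g_sigma => B oB; apply: sub_sigma_algebra.
by apply: (@open_comp (X * X)%type X snd) => // z _; exact: cvg_snd.
Qed.

Lemma measurable_borel_section (A : set BXX) (x : X) :
  measurable A -> measurable ([set y | A (x, y)] : set BX).
Proof.
move=> mA; rewrite -[X in measurable X]setTI.
exact: (@measurable_pair_snd x measurableT A mA).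
Qed.

(** The Borel sigma-algebra of [X * X] may exceed the product sigma-algebra, so
    that the usual theorem on sections does not apply.  For [U] open the
    function is lower semicontinuous: if [O k] is the interior of the set of
    [y] with [ball(x, 1/(k+1)) * y] inside [U], then [O k] increases to the
    section at [x], and it is contained in the sections at all [x'] within
    [1/(k+1)] of [x]. *)
Lemma measurable_section_open (nu : {measure set BX -> \bar R}) (U : set BXX) :
  open (U : set (X * X)%type) ->
  measurable_fun setT (fun x : BX => nu [set y | U (x, y)]).
Proof.
move=> oU.
have mU x : measurable ([set y | U (x, y)] : set BX).
  by apply: measurable_borel_section; exact: sub_sigma_algebra.
apply: (measurability _ (ErealGenOInfty.measurableE R)).
move=> /= _ [_ [a ->]] <-; rewrite setTI preimage_itvoy; apply: sub_sigma_algebra.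
apply: open_from_nbhs => x /= ax.
pose O (k : nat) : set X :=
  interior [set y : X | forall x', ball x k.+1%:R^-1%R x' -> U (x', y)].
have oO k : open (O k) by exact: open_interior.
have mO k : measurable (O k : set BX) by exact: sub_sigma_algebra.
have OU : [set y | U (x, y)] = \bigcup_k O k.
  apply/seteqP; split => [y Uxy|y [k _ /interior_subset Oy]]; last first.
    by apply: Oy; apply: ballxx; rewrite invr_gt0 ltr0n.
  have /nbhs_ballP[e /= e0 eU] : nbhs (x, y) U.
    exact: open_nbhs_nbhs.
  have [k ke] : exists k : nat, (k.+1%:R^-1 <= e)%R.
    exists (Num.truncn e^-1); rewrite -[leRHS]invrK lef_pV2 ?posrE ?invr_gt0 ?ltr0n//.
    exact/ltW/truncnS_gt.
  exists k => //; apply/nbhs_ballP; exists e => //= y' yy' x' xx'.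
  by apply: eU; split => //=; exact: le_ball xx'.
have : nu \o O @ \oo --> nu (\bigcup_k O k).
  apply: nondecreasing_cvg_mu => //; first exact: bigcupT_measurable.
  move=> k l kl; apply/subsetPset; move=> y; apply: filterS => y' /= Hy x' xx'.
  apply: Hy; apply: le_ball xx'.
  by rewrite lef_pV2 ?posrE ?ltr0n// ler_nat ltnS.
move=> cvO.
have [k ak] : exists k, a%:E < nu (O k).
  apply/not_existsP => H.
  have : nu (\bigcup_k O k) <= a%:E.
    rewrite -(cvg_lim _ cvO)//; apply: lime_le.
      by apply/cvg_ex; eexists; exact: cvO.
    by apply: nearW => k /=; rewrite leNgt; apply/negP/H.
  by rewrite -OU leNgt ax.
apply/nbhs_ballP; exists k.+1%:R^-1%R => /=; first by rewrite invr_gt0 ltr0n.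
move=> x' xx' /=; apply: lt_le_trans ak _.
by apply: le_measure; rewrite ?inE// => y /interior_subset; exact.
Qed.

(** By Dynkin induction from open sets; finiteness is what allows complements. *)
Lemma measurable_section_finite (nu : {measure set BX -> \bar R}) (A : set BXX) :
  nu setT < +oo -> measurable A ->
  measurable_fun setT (fun x : BX => nu [set y | A (x, y)]).
Proof.
move=> nufin; apply: (@dynkin_induction _ BXX (@open (X * X)%type)
  (fun A => measurable_fun setT (fun x : BX => nu [set y | A (x, y)]))) => //.
- exact: openI.
- by apply: measurable_section_open; exact: openT.
- by move=> U oU; exact: measurable_section_open.
- move=> S mS mfS.
  rewrite (_ : (fun _ => _) = fun x : BX => nu setT - nu [set y | S (x, y)]).
    by apply: emeasurable_funB => //; exact: measurable_cst.
  apply/funext => x; have mS' := @measurable_borel_section S x mS.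
  by rewrite -[in RHS](setTI [set y | _]) -measureD// setTD.
- move=> F mF tF mfF.
  rewrite (_ : (fun _ => _) = fun x : BX => \sum_(k <oo) nu [set y | F k (x, y)]).
    exact: ge0_emeasurable_sum.
  apply/funext => x.
  rewrite (_ : [set y | _] = \bigcup_k [set y | F k (x, y)])//.
  apply: measure_semi_bigcup => //.
  + by move=> k; exact: measurable_borel_section.
  + apply/trivIsetP => i j _ _ ij; apply/seteqP; split => // y [Fi Fj].
    by have /trivIsetP/(_ i j Logic.I Logic.I ij)/seteqP[+ _] := tF; apply; split; [exact: Fi|exact: Fj].
  + by apply: bigcupT_measurable => k; exact: measurable_borel_section.
Qed.

Variable mu : {sigma_finite_measure set BX -> \bar R}.

Lemma measurable_section_measure (A : set BXX) :
  measurable A -> measurable_fun setT (fun x : BX => mu [set y | A (x, y)]).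
Proof.
move=> mA.
have /sigma_finiteP[F [F_T F_nd F_oo]] := sigma_finiteT mu.
pose nu n : {measure set BX -> \bar R} := mrestr mu (F_oo n).1.
apply: (emeasurable_fun_cvg (fun n (x : BX) => nu n [set y | A (x, y)])).
  move=> n; apply: measurable_section_finite => //.
  by rewrite /nu/= /mrestr setTI; exact: (F_oo n).2.
move=> x _; rewrite /nu/= /mrestr.
rewrite -[X in _ --> mu X]setIT F_T setI_bigcupr.
apply: (@nondecreasing_cvg_mu _ _ _ mu (fun n => [set y | A (x, y)] `&` F n)).
- by move=> n; apply: measurableI; [exact: measurable_borel_section|exact: (F_oo n).1].
- apply: bigcupT_measurable => n.
  by apply: measurableI; [exact: measurable_borel_section|exact: (F_oo n).1].
- by move=> n m nm; apply/subsetPset; apply: setIS; apply/subsetPset/F_nd.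
Qed.

Import HBNNSimple.

Lemma measurable_section_integral (f : BXX -> \bar R) :
  measurable_fun setT f -> (forall z, 0 <= f z) ->
  measurable_fun setT (fun x : BX => \int[mu]_y f (x, y)).
Proof.
move=> mf f0.
pose g := nnsfun_approx measurableT mf.
apply: (emeasurable_fun_cvg (fun n (x : BX) => \int[mu]_y (g n (x, y))%:E)) => //.
- move=> n.
  rewrite (_ : (fun _ => _) = fun x : BX =>
    \sum_(k \in range (g n)) k%:E * mu [set y | (g n @^-1` [set k]) (x, y)]).
    apply: emeasurable_fsum => // r.
    apply: measurable_funeM; apply: (@measurable_section_measure (g n @^-1` [set r])).
    exact: measurable_sfunP.
  apply/funext => x.
  under eq_integral do rewrite fimfunE -fsumEFin//.
  rewrite ge0_integral_fsum //; last 2 first.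
  + move=> i; apply/measurable_EFinP/measurable_funM => //.
    by apply: measurableT_comp (measurable_pair_snd x).
  + by move=> r y _; rewrite EFinM nnfun_muleindic_ge0.
  apply: eq_fsbigr => i; rewrite inE => -[/= t _ <-{i}].
  under eq_fun do rewrite EFinM.
  have m1 : measurable ([set y | (g n @^-1` [set g n t]) (x, y)] : set BX).
    by apply: measurable_borel_section; exact: measurable_sfunP.
  rewrite ge0_integralZl//.
  + by congr (_ * _); rewrite -[in RHS](setIT [set y | _]) -integral_indic.
  + apply/measurable_EFinP.
    by apply: measurableT_comp (measurable_pair_snd x).
  + by rewrite lee_fin.
- move=> x _.
  rewrite [X in _ --> X](_ : _ = \int[mu]_y limn (fun n => (g n (x, y))%:E)).
    apply: cvg_monotone_convergence => //.
    + by move=> n; apply/measurable_EFinP; apply: measurableT_comp (measurable_pair_snd x).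
    + by move=> n y _; rewrite lee_fin.
    + by move=> y _ a b ab; rewrite lee_fin; have /lefP/(_ (x, y)) := nd_nnsfun_approx measurableT mf ab.
  apply: eq_integral => y _; apply/esym/cvg_lim => //.
  exact: (@cvg_nnsfun_approx _ _ _ _ measurableT _ mf (fun x _ => f0 x)).
Qed.

End borel_sections.

(** * Disjoint families of sets of positive measure *)
Section countable_disjoint.
Context d (T : measurableType d) (R : realType) (I : pointedType).
Variable mu : {sigma_finite_measure set T -> \bar R}.
Local Open Scope ereal_scope.

(** With [F n] of finite measure exhausting [T], only finitely many disjoint
    sets can have [mu (B i /\ F n) >= 1 / (m+1)]. *)
Lemma countable_disjoint_gt0 (E : set I) (B : I -> set T) :
  (forall i, measurable (B i)) -> trivIset E B ->
  (forall i, E i -> 0 < mu (B i)) -> countable E.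
Proof.
move=> mB tB B0.
have /sigma_finiteP[F [F_T F_nd F_oo]] := sigma_finiteT mu.
pose En n m := [set i | E i /\ (m.+1%:R^-1)%:E <= mu (B i `&` F n)].
suff finE n m : finite_set (En n m).
  have -> : E = \bigcup_n \bigcup_m En n m.
    apply/seteqP; split => [i Ei|i [n _ [m _ []]]//].
    have [n Fn0] : exists n, 0 < mu (B i `&` F n).
      apply/not_existsP => H; have := B0 _ Ei.
      have cv : mu (B i `&` F n) @[n --> \oo] --> mu (\bigcup_n (B i `&` F n)).
        apply: (@nondecreasing_cvg_mu _ _ _ mu (fun n => B i `&` F n)).
        - by move=> n; apply: measurableI => //; exact: (F_oo n).1.
        - apply: bigcupT_measurable => n.
          by apply: measurableI => //; exact: (F_oo n).1.
        - by move=> n m nm; apply/subsetPset; apply: setIS; apply/subsetPset/F_nd.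
      rewrite -[X in mu X]setIT F_T setI_bigcupr -(cvg_lim _ cv)//.
      rewrite (_ : (fun n => _) = cst 0) ?lim_cst// ?ltxx//.
      apply/funext => n; apply/eqP; rewrite eq_le measure_ge0 andbT leNgt.
      exact/negP/H.
    have [m mE] : exists m : nat, (m.+1%:R^-1)%:E <= mu (B i `&` F n).
      have [fin|] := boolP (mu (B i `&` F n) \is a fin_num); last first.
        by rewrite ge0_fin_numE// -leNgt leye_eq => /eqP ->; exists 0%N; rewrite leey.
      exists (Num.truncn (fine (mu (B i `&` F n)))^-1).
      rewrite -[leRHS]fineK// lee_fin -[leRHS]invrK.
      rewrite lef_pV2 ?posrE ?invr_gt0 ?ltr0n ?fine_gt0// ?Fn0 ?ltey_eq ?fin//.
      exact/ltW/truncnS_gt.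
    by exists n => //; exists m.
  apply: bigcup_countable => // n _; apply: bigcup_countable => // m _.
  exact: finite_set_countable.
apply: contrapT => /infiniteP/pcard_leP[f].
pose G k := B (f k) `&` F n.
have Ef k : En n m (f k) by have := 'funS_f; apply.
have mG k : measurable (G k) by apply: measurableI => //; exact: (F_oo n).1.
have tG : trivIset setT G.
  apply/trivIsetP => k l _ _ kl; apply/seteqP; split => // y [[Bk _] [Bl _]].
  move/trivIsetP : tB => /(_ _ _ (Ef k).1 (Ef l).1).
  have kl' : f k != f l.
    by apply: contra kl => /eqP e; apply/eqP; apply: ('inj_f) e; rewrite inE.
  by move=> /(_ kl')/seteqP[+ _]; apply; split; [exact: Bk|exact: Bl].
have GF : \sum_(k <oo) mu (G k) <= mu (F n).
  rewrite -measure_semi_bigcup//; last exact: bigcupT_measurable.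
  apply: le_measure; rewrite ?inE; [exact: bigcupT_measurable|exact: (F_oo n).1|].
  by move=> y [k _ []].
have fF : mu (F n) \is a fin_num by rewrite ge0_fin_numE//; exact: (F_oo n).2.
pose N := (Num.truncn (fine (mu (F n)) * m.+1%:R)%R).+1.
have : (N%:R * m.+1%:R^-1)%:E <= mu (F n).
  apply: le_trans GF; apply: (@le_trans _ _ (\sum_(0 <= k < N) mu (G k))); last first.
    by apply: nneseries_lim_ge => k _ _.
  rewrite (@le_trans _ _ (\sum_(0 <= k < N) (m.+1%:R^-1)%:E))//.
    by rewrite sumEFin sumr_const_nat subn0 mulr_natl.
  by apply: lee_sum => k _; exact: (Ef k).2.
rewrite -[leRHS]fineK// lee_fin ler_pdivrMr ?ltr0n// leNgt => /negP; apply.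
exact: truncnS_gt.
Qed.

End countable_disjoint.

(** * Quasi-metric kernels *)
Section quasi_metric.
Context (R : realType) (X : pmetricType R) (K : X -> X -> \bar R).
Local Notation BX := (borelType X).
Local Notation BXX := (borelType (X * X)%type).
Implicit Types (mu nu : {sigma_finite_measure set BX -> \bar R}).
Implicit Types (g h : X -> \bar R).

(** The real-valued form of [1 / K]: as [K > 0], [1 / K] is finite, and where
    [K = +oo] both [fine] and the inverse of [0] give the right value [0]. *)
Definition qdist (x y : X) : R := ((fine (K x y))^-1)%R.

Definition qball (x : X) (t : R) : set BX := [set y | (qdist x y <= t)%R].

Local Open Scope ereal_scope.

Hypothesis mK : measurable_fun [set: BXX] (fun z : BXX => K z.1 z.2).
Hypothesis K_gt0 : forall x y, 0 < K x y.
Hypothesis K_sym : forall x y, K x y = K y x.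
Variable kappa : R.
Hypothesis kappa1 : (1 <= kappa)%R.
Hypothesis K_quasi : forall x y z,
  (K x y)^-1 <= kappa%:E * ((K x z)^-1 + (K z y)^-1).

Lemma K_ge0 x y : 0 <= K x y. Proof. exact/ltW/K_gt0. Qed.

Lemma qdist_ge0 x y : (0 <= qdist x y)%R.
Proof. by rewrite invr_ge0 fine_ge0// K_ge0. Qed.

#[local] Hint Resolve K_ge0 qdist_ge0 : core.

Lemma rho_qdist x y : rho K x y = (qdist x y)%:E.
Proof.
rewrite /rho /qdist; have := K_gt0 x y; case: (K x y) => [r| |]//=; last first.
  by rewrite invr0.
by rewrite lte_fin => r0; rewrite inver gt_eqF.
Qed.

Lemma K_qdist x y : K x y = ((qdist x y)%:E)^-1.
Proof.
rewrite /qdist; have := K_gt0 x y; case: (K x y) => [r| |]//=; last first.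
  by rewrite invr0 inve0.
by rewrite lte_fin => r0; rewrite inver invr_eq0 gt_eqF// invrK.
Qed.

Lemma rho_ball_qball x a : rho_ball K x a = qball x a.
Proof. by apply/seteqP; split => y; rewrite /rho_ball /qball/= rho_qdist lee_fin. Qed.

Lemma qdist_sym x y : qdist x y = qdist y x.
Proof. by rewrite /qdist K_sym. Qed.

Lemma qdist_triangle x y z : (qdist x y <= kappa * (qdist x z + qdist z y))%R.
Proof.
have := K_quasi x y z.
by rewrite -[(K x y)^-1]/(rho K x y) -[(K x z)^-1]/(rho K x z)
  -[(K z y)^-1]/(rho K z y) !rho_qdist -EFinD -EFinM lee_fin.
Qed.

Lemma measurable_K_section x : measurable_fun [set: BX] (K x).
Proof. exact: (@measurableT_comp _ _ _ BX BXX (\bar R) (fun z : BXX => K z.1 z.2) setT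
  (fun y : BX => (x, y) : BXX) mK (@measurable_pair_snd R X x)). Qed.

Lemma measurable_qdist x : measurable_fun [set: BX] (qdist x).
Proof.
apply: measurable_fun_invr_ge0; first by move=> y; rewrite fine_ge0// K_ge0.
exact: (measurableT_comp (fine_measurable (@measurableT _ (\bar R))) (measurable_K_section x)).
Qed.

Lemma measurable_qball x t : measurable (qball x t).
Proof.
rewrite -[X in measurable X]setTI; apply: measurable_fun_le => //.
exact: measurable_qdist.
Qed.

Lemma measurable_K_mul x g : measurable_fun [set: BX] g ->
  measurable_fun [set: BX] (fun y => K x y * g y).
Proof. by move=> mg; apply: emeasurable_funM => //; exact: measurable_K_section. Qed.

Lemma operator_ge0 mu g x : (forall y, 0 <= g y) -> 0 <= operator K mu g x.
Proof. by move=> g0; apply: integral_ge0 => y _; rewrite mule_ge0// K_ge0. Qed.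

Lemma measurable_operator mu g : measurable_fun [set: BX] g ->
  (forall y, 0 <= g y) -> measurable_fun [set: BX] (operator K mu g).
Proof.
move=> mg g0.
apply: (@measurable_section_integral _ _ mu (fun z : BXX => K z.1 z.2 * g z.2)).
  apply: emeasurable_funM => //.
  exact: (measurableT_comp mg (@measurable_borel_snd _ X)).
by move=> z; rewrite mule_ge0// K_ge0.
Qed.

Lemma le_operator mu g h x : (forall y, 0 <= g y) -> (forall y, g y <= h y) ->
  operator K mu g x <= operator K mu h x.
Proof.
move=> g0 gh; apply: ge0_integral_mono => y _; first by rewrite mule_ge0// K_ge0.
by rewrite lee_wpmul2l// K_ge0.
Qed.

Lemma operatorZ mu g (k : \bar R) x : measurable_fun [set: BX] g ->
  (forall y, 0 <= g y) -> 0 <= k ->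
  operator K mu (fun y => k * g y) x = k * operator K mu g x.
Proof.
move=> mg g0 k0; rewrite /operator -ge0_integralZl//.
- by apply: eq_integral => y _; rewrite muleCA.
- exact: measurable_K_mul.
- by move=> y _; rewrite mule_ge0// K_ge0.
Qed.

Lemma kappa_gt0 : (0 < kappa)%R. Proof. exact: lt_le_trans ltr01 kappa1. Qed.

Lemma kappa2_gt0 : (0 < 2 * kappa)%R. Proof. by rewrite mulr_gt0// kappa_gt0. Qed.

#[local] Hint Resolve kappa_gt0 kappa2_gt0 : core.

(** Points at least as far from [x] as [y] is see [x] and [y] at comparable
    distances. *)
Lemma K_le_far x y z : (qdist x y <= qdist x z)%R ->
  K x z <= (2 * kappa)%:E * K y z.
Proof.
move=> yz; rewrite (K_qdist x z) (K_qdist y z); apply: lee_inve_scale.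
- exact: kappa2_gt0.
- exact: qdist_ge0.
apply: (le_trans (qdist_triangle y z x)).
rewrite (qdist_sym y x) (mulrC 2%R) -mulrA ler_pM2l ?kappa_gt0//; lra.
Qed.

(** Tail powers for [r = rho(x, .)] and [k = K(x, .) g]: by [K_le_far] the tail
    beyond [y] is at most [2 kappa K g (y)]. *)
Lemma operator_poweR mu g (t : R) x : measurable_fun [set: BX] g ->
  (forall y, 0 <= g y) -> (0 <= t)%R ->
  (operator K mu g x) `^ (t + 1) <=
  (2%:E `^ (t + 1) * (2 * kappa)%:E `^ t) *
  operator K mu (fun y => g y * (operator K mu g y) `^ t) x.
Proof.
move=> mg g0 t0.
have mT : measurable_fun [set: BX] (fun y => operator K mu g y `^ t).
  exact: (measurableT_comp (measurable_poweR t) (measurable_operator mu mg g0)).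
have T0 y : 0 <= operator K mu g y `^ t by exact: poweR_ge0.
have Kg0 y : 0 <= K x y * g y by rewrite mule_ge0// K_ge0.
have := @integral_tail_poweR _ BX _ mu (qdist x) (fun y => K x y * g y) setT t
  measurableT (measurable_qdist x) (measurable_K_mul x mg) (qdist_ge0 x) Kg0 t0.
move/le_trans; apply.
rewrite -[leRHS]muleA lee_wpmul2l ?poweR_ge0// -operatorZ ?poweR_ge0//; last 2 first.
- exact: emeasurable_funM.
- by move=> y; rewrite mule_ge0.
apply: ge0_integral_mono => y _.
  by rewrite !mule_ge0 ?K_ge0 ?poweR_ge0.
rewrite -muleA lee_wpmul2l ?K_ge0// muleCA lee_wpmul2l//.
rewrite -poweRM ?operator_ge0//; last by rewrite lee_fin ltW// kappa2_gt0.
apply: lee_poweR => //.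
  by apply: integral_ge0 => z _; rewrite mule_ge0// K_ge0.
rewrite /operator -ge0_integralZl//; last 3 first.
- exact: measurable_K_mul.
- by move=> z _; rewrite mule_ge0// K_ge0.
- by rewrite lee_fin ltW// kappa2_gt0.
apply: ge0_integral_subset => // z.
  by rewrite !mule_ge0 ?K_ge0// lee_fin ltW// kappa2_gt0.
rewrite setTI/= => yz; rewrite mule_ge0 ?K_ge0//= muleA lee_wpmul2r//.
exact: K_le_far.
Qed.

(** The centres of a maximal disjoint family of balls of radius [t] and positive
    measure: a ball that meets one of them has its centre within
    [2 kappa t]. *)
Lemma countable_net mu (t : R) : exists e : nat -> X,
  forall x, 0 < mu (qball x t) -> exists n, (qdist (e n) x <= 2 * kappa * t)%R.
Proof.
have [E [EB tE Emax]] := @ex_maximal_disjoint_subcollection X X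
  (fun x => qball x t) [set x | 0 < mu (qball x t)].
have /countable_injP[f finj] : countable E.
  apply: (@countable_disjoint_gt0 _ BX R X mu E (fun x => qball x t)) => // x.
  exact: measurable_qball.
pose e n : X := xget point [set x | E x /\ f x = n].
have eE x : E x -> e (f x) = x.
  rewrite /e => Ex; case: xgetP => [y _ [Ey fy]|/(_ x) []//].
  by apply: finj => //; rewrite inE.
have meet x y z : (qdist x z <= t)%R -> (qdist y z <= t)%R ->
    (qdist x y <= 2 * kappa * t)%R.
  move=> xz yz; apply: (le_trans (qdist_triangle x y z)).
  rewrite (qdist_sym z y) (mulrC 2%R) -mulrA ler_pM2l ?kappa_gt0//; lra.
exists e => x x0.
have [[i Ei [z [iz xz]]]|H] := pselect (exists2 i, E i & qball i t `&` qball x t !=set0).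
  by exists (f i); rewrite eE//; exact: meet iz xz.
exfalso; apply: (Emax (E `|` [set x])).
- split; first by move=> ? ?; left.
  move=> /(_ x (or_intror erefl)) Ex; apply: H; exists x => //; rewrite setIid.
  by apply/set0P; apply/eqP => q0; move: x0; rewrite q0 measure0 ltxx.
- by move=> y [/EB//|->].
- move=> i j [Ei|->] [Ej|->]; first exact: tE.
  + by move=> ij; exfalso; apply: H; exists i.
  + by rewrite setIC => ij; exfalso; apply: H; exists j.
  + by [].
Qed.

Lemma measurable_qball_integral mu g t : measurable_fun [set: BX] g ->
  (forall y, 0 <= g y) ->
  measurable_fun [set: BX] (fun x : BX => \int[mu]_(y in qball x t) g y).
Proof.
move=> mg g0.
rewrite (_ : (fun _ => _) = fun x : BX =>
  \int[mu]_y (((qdist x y <= t)%R%:R)%:E * g y)); last first.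
  by apply/funext => x; rewrite -integral_set_bool.
apply: (@measurable_section_integral _ _ mu
  (fun z : BXX => ((qdist z.1 z.2 <= t)%R%:R)%:E * g z.2)).
  apply: emeasurable_funM; last exact: (measurableT_comp mg (@measurable_borel_snd _ X)).
  apply: (@measurable_ler_nat R _ BXX (fun z : BXX => qdist z.1 z.2)) => //.
  apply: measurable_fun_invr_ge0; first by move=> y; rewrite fine_ge0// K_ge0.
  exact: (measurableT_comp (fine_measurable (@measurableT _ (\bar R))) mK).
by move=> z; rewrite mule_ge0// lee_fin ler0n.
Qed.

(** The balls [Q n] of radius [2 kappa t] around a countable net cover all [x]
    with [mu (B_t(x)) > 0].  Made disjoint, they split the left-hand side into a
    series; for [x] in [Q n], [B_t(x)] lies in the ball of radius
    [3 kappa^2 t] around [e n], which does not depend on [x].  The sums can then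
    be regrouped, as [Q n] lies within [5 kappa^3 t] of each point of
    that larger ball. *)
Lemma tonelli_qball mu nu g h (t : R) :
  measurable_fun [set: BX] g -> measurable_fun [set: BX] h ->
  (forall y, 0 <= g y) -> (forall y, 0 <= h y) -> (0 <= t)%R ->
  \int[nu]_x (h x * \int[mu]_(y in qball x t) g y) <=
  \int[mu]_y (g y * \int[nu]_(x in qball y (5 * kappa ^+ 3 * t)) h x).
Proof.
move=> mg mh g0 h0 t0; have [e He] := countable_net mu t.
have k0 := kappa_gt0.
pose Q n : set BX := qball (e n) (2 * kappa * t).
have mQ n : measurable (Q n) by exact: measurable_qball.
pose P := seqDU Q.
have mP n : measurable (P n).
  exact: seqDU_measurable.
have PQ n : P n `<=` Q n by move=> x [].
have tP : trivIset setT P := trivIset_seqDU Q.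
have PU : \bigcup_n P n = \bigcup_n Q n by rewrite /P -seqDU_bigcup_eq.
pose m n := \int[mu]_(y in qball (e n) (3 * kappa ^+ 2 * t)) g y.
pose w n := \int[nu]_(x in P n) h x.
have m0 n : 0 <= m n by exact: integral_ge0.
have w0 n : 0 <= w n by exact: integral_ge0.
pose F n y := ((qdist (e n) y <= 3 * kappa ^+ 2 * t)%R%:R)%:E * g y * w n.
have F0 n y : 0 <= F n y by rewrite /F !mule_ge0// lee_fin ler0n.
have mF n : measurable_fun [set: BX] (F n).
  apply: emeasurable_funM => //; apply: emeasurable_funM => //.
  by apply: measurable_ler_nat => //; exact: measurable_qdist.
have mG := @measurable_qball_integral mu g t mg g0.
apply: (@le_trans _ _ (\sum_(n <oo) (w n * m n))).
  rewrite (_ : \int[nu]_x _ =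
    \int[nu]_(x in \bigcup_n P n) (h x * \int[mu]_(y in qball x t) g y)); last first.
    rewrite [RHS]integral_mkcond; apply: eq_integral => x _; rewrite patchE.
    case: ifPn => // /negP nx.
    suff : mu (qball x t) = 0.
      move=> q0; rewrite null_set_integral ?mule0//.
      - exact: measurable_qball.
      - exact: measurable_funTS.
    apply/eqP; rewrite eq_le measure_ge0 andbT leNgt; apply/negP => /He[n xn].
    by apply: nx; rewrite inE PU; exists n.
  rewrite ge0_integral_bigcup//; last 2 first.
  - by apply: measurable_funTS; exact: emeasurable_funM.
  - by move=> x _; rewrite mule_ge0// integral_ge0.
  apply: lee_nneseries => n _; first by rewrite integral_ge0// => x _; rewrite mule_ge0// integral_ge0.
  have -> : w n * m n = \int[nu]_(x in P n) (h x * m n).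
    by rewrite ge0_integralZr//; exact: measurable_funTS.
  apply: ge0_integral_mono => x Px; first by rewrite mule_ge0// integral_ge0.
  rewrite lee_wpmul2l//; apply: ge0_integral_subset => // [y xy|y _]; last by rewrite g0/=.
  apply: (le_trans (qdist_triangle _ _ x)).
  have := PQ _ _ Px; rewrite /Q /qball/= => ex; move: xy; rewrite /qball/= => xy.
  rewrite (_ : 3 * kappa ^+ 2 * t = kappa * (3 * (kappa * t)))%R; last by ring.
  rewrite ler_pM2l//; have : (t <= kappa * t)%R by rewrite ler_peMl.
  by move: ex xy; lra.
apply: (@le_trans _ _ (\int[mu]_y \sum_(n <oo) F n y)).
  rewrite integral_nneseries//; apply: lee_nneseries => n _; first by rewrite mule_ge0.
  rewrite /F ge0_integralZr//; last 2 first.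
  - by apply: emeasurable_funM => //; apply: measurable_ler_nat => //; exact: measurable_qdist.
  - by move=> y _; rewrite mule_ge0// lee_fin ler0n.
  by rewrite muleC /m /qball integral_set_bool.
apply: ge0_integral_mono => y _; first exact: nneseries_ge0.
rewrite (@eq_eseriesr _ _ (fun n => g y * (((qdist (e n) y <= 3 * kappa ^+ 2 * t)%R%:R)%:E * w n))); last first.
  by move=> n _; rewrite /F -muleA muleCA.
apply: lime_le.
  by apply: is_cvg_nneseries => n _ _; rewrite !mule_ge0// lee_fin ler0n.
apply: nearW => N; rewrite -ge0_sume_distrr; last first.
  by move=> n _; rewrite mule_ge0// lee_fin ler0n.
rewrite lee_wpmul2l//.
apply: (le_trans (nneseries_lim_ge _ _)).
  by move=> n _ _; rewrite mule_ge0// lee_fin ler0n.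
apply: (@le_trans _ _ (\sum_(n <oo) \int[nu]_(x in P n `&` qball y (5 * kappa ^+ 3 * t)) h x)).
  apply: lee_nneseries => n _; first by rewrite mule_ge0// lee_fin ler0n.
  case: (boolP (qdist (e n) y <= 3 * kappa ^+ 2 * t)%R) => /= [ey|_]; last by rewrite mul0e integral_ge0.
  rewrite mul1e; apply: ge0_integral_subset => // [x Px|x _]; last by rewrite h0/=.
  split => //=; apply: (le_trans (qdist_triangle _ _ (e n))).
  have := PQ _ _ Px; rewrite /Q /qball/= => ex.
  rewrite (_ : 5 * kappa ^+ 3 * t = kappa * (5 * (kappa * (kappa * t))))%R; last by ring.
  rewrite ler_pM2l// (qdist_sym y).
  have : (kappa * t <= kappa * (kappa * t))%R by rewrite ler_peMl// mulr_ge0// ltW.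
  rewrite (_ : 3 * kappa ^+ 2 * t = 3 * (kappa * (kappa * t)))%R in ey; last by ring.
  by move: ex ey; lra.
rewrite -ge0_integral_bigcup//; last 3 first.
- by move=> n; apply: measurableI => //; exact: measurable_qball.
- exact: measurable_funTS.
- apply/trivIsetP => i j _ _ ij; apply/seteqP; split => // x [[Pi _] [Pj _]].
  by move/trivIsetP : tP => /(_ _ _ Logic.I Logic.I ij)/seteqP[+ _]; apply; split; [exact: Pi|exact: Pj].
by apply: ge0_integral_subset => // [x [n _ []]//|x _]; rewrite h0/=.
Qed.

(** For open balls [t |-> mu (qball_open x t)] is left-continuous, which gives
    measurability in [(x, t)] jointly. *)
Definition qball_open (x : X) (t : R) : set BX := [set y | (qdist x y < t)%R].

Lemma measurable_qball_open x t : measurable (qball_open x t).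
Proof.
rewrite -[X in measurable X]setTI.
rewrite (_ : qball_open x t = ~` [set y | (cst t y <= qdist x y)%R]).
  apply: measurableI => //; apply: measurableC.
  rewrite -[X in measurable X]setTI; apply: measurable_fun_le => //.
  exact: measurable_qdist.
by apply/seteqP; split => y; rewrite /qball_open/= ltNge => /negP.
Qed.

Lemma measurable_qball_open_integral mu g t : measurable_fun [set: BX] g ->
  (forall y, 0 <= g y) ->
  measurable_fun [set: BX] (fun x : BX => \int[mu]_(y in qball_open x t) g y).
Proof.
move=> mg g0.
rewrite (_ : (fun _ => _) = fun x : BX =>
  \int[mu]_y (((qdist x y < t)%R%:R)%:E * g y)); last first.
  by apply/funext => x; rewrite -integral_set_bool.
apply: (@measurable_section_integral _ _ mu
  (fun z : BXX => ((qdist z.1 z.2 < t)%R%:R)%:E * g z.2)).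
  apply: emeasurable_funM; last exact: (measurableT_comp mg (@measurable_borel_snd _ X)).
  apply: (@measurable_ltr_nat R _ BXX (fun z : BXX => qdist z.1 z.2)) => //.
  apply: measurable_fun_invr_ge0; first by move=> y; rewrite fine_ge0// K_ge0.
  exact: (measurableT_comp (fine_measurable (@measurableT _ (\bar R))) mK).
by move=> z; rewrite mule_ge0// lee_fin ler0n.
Qed.

(** By monotonicity and left-continuity in [t], the integral exceeds [a] at
    [(x, t)] exactly if it does at [(x, r)] for some rational [r <= t]. *)
Lemma measurable_qball_open_joint mu g : measurable_fun [set: BX] g ->
  (forall y, 0 <= g y) ->
  measurable_fun [set: BX * R] (fun z : BX * R => \int[mu]_(y in qball_open z.1 z.2) g y).
Proof.
move=> mg g0; pose m (x : BX) (t : R) := \int[mu]_(y in qball_open x t) g y.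
have m_mono x s t : (s <= t)%R -> m x s <= m x t.
  move=> st; apply: ge0_integral_subset => // [y /= h|y _]; last by rewrite g0/=.
  exact: lt_le_trans h st.
apply: (measurability _ (ErealGenOInfty.measurableE R)).
move=> /= _ [_ [a ->]] <-; rewrite setTI preimage_itvoy.
rewrite (_ : [set z | _] =
  \bigcup_(r : rat) ([set x : BX | a%:E < m x (ratr r)] `*` [set t | (ratr r <= t)%R])).
  apply: bigcupT_measurable_rat => r; apply: measurableX.
    have := @measurable_qball_open_integral mu g (ratr r) mg g0 measurableT `]a%:E, +oo[%classic.
    by rewrite setTI preimage_itvoy; apply; exact: emeasurable_itv.
  rewrite (_ : [set t | _] = `[ratr r, +oo[%classic)//.
  by apply/seteqP; split => t /=; rewrite in_itv/= andbT.
apply/seteqP; split => [[x t] /= h|[x t] [r _ [/= h rt]]]; last first.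
  exact: lt_le_trans h (m_mono _ _ _ rt).
have [n hn] : exists n : nat, a%:E < m x (t - n.+1%:R^-1)%R.
  apply/not_existsP => H.
  have : m x t <= a%:E.
    rewrite /m (_ : qball_open x t = \bigcup_n qball_open x (t - n.+1%:R^-1)%R).
      apply: integral_bigcup_le => //.
      - move=> i j ij y /= /lt_le_trans; apply.
        by rewrite lerD2l lerN2 lef_pV2 ?posrE ?ltr0n// ler_nat ltnS.
      - by move=> n; exact: measurable_qball_open.
      - by move=> n; rewrite leNgt; apply/negP/H.
    apply/seteqP; split => [y /= yt|y [n _ /= /lt_le_trans]]; last first.
      by apply; rewrite gerBl invr_ge0 ler0n.
    exists (Num.truncn (t - qdist x y)^-1) => //=.
    rewrite /qball_open/= ltrBrDr -ltrBrDl -[ltRHS]invrK ltf_pV2 ?posrE ?invr_gt0 ?subr_gt0 ?ltr0n//.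
    exact: truncnS_gt.
  by rewrite leNgt h.
have [r /andP[r1 r2]] : exists r : rat, (t - n.+1%:R^-1 <= ratr r <= t)%R.
  have /rat_in_itvoo[r] : (t - n.+1%:R^-1 < t)%R by rewrite gtrBl invr_gt0 ltr0n.
  by rewrite in_itv/= => /andP[/ltW r1 /ltW r2]; exists r; rewrite r1.
by exists r => //; split => //=; exact: lt_le_trans hn (m_mono _ _ _ r1).
Qed.

(** Integrating over balls of radius [c t] instead of [t] only rescales [rho],
    hence the factor [c]; this turns an enlargement of the balls into a
    constant. *)
Lemma operator_layer mu g x (c : R) : measurable_fun [set: BX] g ->
  (forall y, 0 <= g y) -> (0 < c)%R ->
  \int[lebesgue_measure]_(t in `]0%R, +oo[)
    ((\int[mu]_(y in qball x (c * t)) g y) * invsq t) =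
  c%:E * operator K mu g x.
Proof.
move=> mg g0 c0.
have mq : measurable_fun [set: BX] (fun y => qdist x y / c)%R.
  by apply: measurable_funM => //; exact: measurable_qdist.
have q0 y : (0 <= qdist x y / c)%R by rewrite divr_ge0 ?qdist_ge0 ?ltW.
transitivity (\int[lebesgue_measure]_(t in `]0%R, +oo[)
    ((\int[mu]_(y in [set y | (qdist x y / c <= t)%R]) g y) * invsq t)).
  apply: eq_integral => t _; congr (_ * _).
  rewrite (_ : qball x (c * t) = [set y | (qdist x y / c <= t)%R])//.
  by apply/seteqP; split => y; rewrite /qball/= ler_pdivrMr// mulrC.
rewrite (layer_cake mu mq mg q0 g0 (lexx _)).
rewrite -operatorZ//; last by rewrite lee_fin ltW.
apply: eq_integral => y _; rewrite muleC [RHS]muleA [K x y * _]muleC; congr (_ * _).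
rewrite max_r// K_qdist; have := qdist_ge0 x y.
rewrite le_eqVlt => /predU1P[<-|h].
  by rewrite mul0r inve0 gt0_muley// lte_fin.
by rewrite !inver !gt_eqF ?divr_gt0// -EFinM invf_div.
Qed.

Lemma tonelli_layer mu nu g h (a : R) :
  measurable_fun [set: BX] g -> measurable_fun [set: BX] h ->
  (forall y, 0 <= g y) -> (forall y, 0 <= h y) ->
  \int[nu]_x (h x * \int[lebesgue_measure]_(t in `]0%R, +oo[)
    ((\int[mu]_(y in qball_open x (a * t)) g y) * invsq t)) =
  \int[lebesgue_measure]_(t in `]0%R, +oo[)
    ((\int[nu]_x (h x * \int[mu]_(y in qball_open x (a * t)) g y)) * invsq t).
Proof.
move=> mg mh g0 h0.
pose m (z : BX * R) := \int[mu]_(y in qball_open z.1 (a * z.2)) g y.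
have m0 z : 0 <= m z by exact: integral_ge0.
have mm : measurable_fun [set: BX * R] m.
  have mphi : measurable_fun setT (fun z : BX * R => (z.1, a * z.2)%R).
    apply/measurable_fun_pairP; split; first exact: measurable_fst.
    by apply: measurable_funM => //; exact: measurable_snd.
  exact: (measurableT_comp (measurable_qball_open_joint mu mg g0) mphi).
pose F (z : BX * R) := h z.1 * ((((0 < z.2)%R%:R)%:E) * (m z * invsq z.2)).
have F0 z : 0 <= F z by rewrite /F !mule_ge0 ?invsq_ge0// lee_fin ler0n.
have mF : measurable_fun [set: BX * R] F.
  apply: emeasurable_funM; first exact: measurableT_comp mh measurable_fst.
  apply: emeasurable_funM; first by apply: measurable_ltr_nat => //; exact: measurable_snd.
  apply: emeasurable_funM => //.
  exact: measurableT_comp (@measurable_invsq R) measurable_snd.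
transitivity (\int[nu]_x \int[lebesgue_measure]_t F (x, t)).
  apply: eq_integral => x _; rewrite integral_itvoy /F/= ge0_integralZl//.
  - apply: emeasurable_funM; first exact: measurable_ltr_nat.
    apply: emeasurable_funM; last exact: measurable_invsq.
    by apply: measurableT_comp mm _; exact: measurable_pair1.
  - by move=> t _; rewrite !mule_ge0 ?invsq_ge0// lee_fin ler0n.
rewrite fubini_tonelli// [RHS]integral_itvoy; apply: eq_integral => t _.
have mhm : measurable_fun [set: BX] (fun x => h x * m (x, t)).
  apply: emeasurable_funM => //.
  by apply: measurableT_comp mm _; exact: measurable_pair2.
rewrite (_ : \int[nu]_x F (x, t) =
    \int[nu]_x ((((0 < t)%R%:R)%:E * invsq t) * (h x * m (x, t)))); last first.
  apply: eq_integral => x _; rewrite /F/= muleCA -[RHS]muleA; congr (_ * _).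
  by rewrite muleA muleC.
rewrite ge0_integralZl//.
- by rewrite -muleA; congr (_ * _); exact: muleC.
- by move=> x _; rewrite mule_ge0.
- by rewrite mule_ge0 ?invsq_ge0// lee_fin ler0n.
Qed.

(** [tonelli_qball] integrated over all scales.  Passing to open balls of radius
    [t] from closed ones of radius [t / 2], and to open balls of radius
    [10 kappa^3 t] from closed ones of radius [5 kappa^3 t], makes Tonelli in
    [(x, t)] available on both sides. *)
Lemma tonelli_operator mu nu g h :
  measurable_fun [set: BX] g -> measurable_fun [set: BX] h ->
  (forall y, 0 <= g y) -> (forall y, 0 <= h y) ->
  \int[nu]_x (h x * operator K mu g x) <=
  (20 * kappa ^+ 3)%:E * \int[mu]_y (g y * operator K nu h y).
Proof.
move=> mg mh g0 h0; have k0 := kappa_gt0.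
pose c := (10 * kappa ^+ 3)%R.
have c0 : (0 < c)%R by rewrite mulr_gt0// exprn_gt0.
have half0 : (0 < 2^-1 :> R)%R by rewrite invr_gt0.
suff H : (2^-1)%:E * \int[nu]_x (h x * operator K mu g x) <=
    c%:E * \int[mu]_y (g y * operator K nu h y).
  rewrite (_ : 20 * kappa ^+ 3 = 2 * c)%R; last by rewrite /c; ring.
  rewrite EFinM -muleA; apply: le_trans (lee_wpmul2l _ H) => //.
  by rewrite muleA -EFinM divff// mul1e.
have mKg := measurable_operator mu mg g0.
have mKh := measurable_operator nu mh h0.
rewrite -ge0_integralZl//; last 2 first.
- exact: emeasurable_funM.
- by move=> x _; rewrite mule_ge0// operator_ge0.
apply: (@le_trans _ _ (\int[nu]_x (h x * \int[lebesgue_measure]_(t in `]0%R, +oo[)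
    ((\int[mu]_(y in qball_open x (1 * t)) g y) * invsq t)))).
  apply: ge0_integral_mono => x _.
    by rewrite !mule_ge0 ?operator_ge0// lee_fin.
  rewrite muleCA lee_wpmul2l// -(operator_layer mu x mg g0 half0).
  apply: ge0_integral_mono => t; rewrite /= in_itv/= andbT => t0.
    by rewrite mule_ge0 ?invsq_ge0// integral_ge0.
  rewrite lee_wpmul2r ?invsq_ge0//; apply: ge0_integral_subset => // y.
    by rewrite /qball /qball_open/=; lra.
  by rewrite g0/=.
rewrite tonelli_layer//.
apply: (@le_trans _ _ (\int[lebesgue_measure]_(t in `]0%R, +oo[)
      ((\int[mu]_y (g y * \int[nu]_(x in qball_open y (c * t)) h x)) * invsq t))).
  apply: ge0_integral_mono => t; rewrite /= in_itv/= andbT => t0.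
    by rewrite mule_ge0 ?invsq_ge0// integral_ge0// => x _; rewrite mule_ge0// integral_ge0.
  rewrite lee_wpmul2r ?invsq_ge0//.
  apply: (@le_trans _ _ (\int[nu]_x (h x * \int[mu]_(y in qball x t) g y))).
    apply: ge0_integral_mono => x _; first by rewrite mule_ge0// integral_ge0.
    rewrite lee_wpmul2l//; apply: ge0_integral_subset => // y.
      by rewrite /qball /qball_open/= mul1r; exact: ltW.
    by rewrite g0/=.
  apply: (le_trans (tonelli_qball mu nu mg mh g0 h0 (ltW t0))).
  apply: ge0_integral_mono => y _; first by rewrite mule_ge0// integral_ge0.
  rewrite lee_wpmul2l//; apply: ge0_integral_subset => // x.
    rewrite /qball /qball_open/= => /le_lt_trans; apply.
    by rewrite ltr_pM2r// ltr_pM2r ?exprn_gt0//; lra.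
  by rewrite h0/=.
rewrite -tonelli_layer// -ge0_integralZl//; last 3 first.
- exact: emeasurable_funM.
- by move=> x _; rewrite mule_ge0// operator_ge0.
- by rewrite lee_fin ltW.
apply: ge0_integral_mono => y _.
  by rewrite mule_ge0// integral_ge0// => t _; rewrite mule_ge0 ?invsq_ge0// integral_ge0.
rewrite muleCA lee_wpmul2l// -(operator_layer nu y mh h0 c0).
apply: ge0_integral_mono => t _; first by rewrite mule_ge0 ?invsq_ge0// integral_ge0.
rewrite lee_wpmul2r ?invsq_ge0//; apply: ge0_integral_subset => // x.
  by rewrite /qball /qball_open/=; exact: ltW.
by rewrite h0/=.
Qed.

(** * From a supersolution to a solution *)

#[local] Hint Resolve measurable_K_section measurable_qdist measurable_qball : core.

Lemma operator_limn mu (g : nat -> X -> \bar R) x :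
  (forall n, measurable_fun [set: BX] (g n)) -> (forall n y, 0 <= g n y) ->
  (forall y, {homo g ^~ y : n m / (n <= m)%N >-> n <= m}) ->
  operator K mu (fun y => limn (g ^~ y)) x = limn (fun n => operator K mu (g n) x).
Proof.
move=> mg g0 ndg.
have cv := @cvg_monotone_convergence _ BX R mu setT measurableT
  (fun n y => K x y * g n y).
rewrite /operator (cvg_lim _ (cv _ _ _))//.
- by apply: eq_integral => y _; rewrite limn_ge0_muleZ.
- by move=> n; exact: measurable_K_mul.
- by move=> n y _; rewrite mule_ge0.
- by move=> y _ n m nm; rewrite lee_wpmul2l// ndg.
Qed.

(** The iterates [u_(n+1) = K u_n^q + eps f], [u_0 = 0], increase, and they stay
    below [2 eps f]: if [u_n <= 2 eps f], then
    [K u_n^q <= (2 eps)^q K f^q <= (2 eps)^q C' f = eps f] for the right [eps].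
    Their limit solves the equation by monotone convergence. *)
Lemma supersolution_calZ mu (f : X -> \bar R) (q C : R) :
  (1 < q)%R -> measurable_fun [set: BX] f -> (forall x, 0 <= f x) ->
  {ae mu, forall x, operator K mu (fun y => f y `^ q) x <= C%:E * f x /\ f x < +oo} ->
  calZ K mu q f.
Proof.
move=> q1 mf f0 H; have q0 : (0 < q)%R by exact: lt_trans q1.
pose C' : R := Num.max C 1%R.
have C'0 : (0 < C')%R by rewrite lt_max ltr01 orbT.
(* The solution of [(2 eps)^q C' = eps], which exists since [q > 1]. *)
pose eps : R := ((2 `^ q * C') `^ (- (q - 1)^-1))%R.
have A0 : (0 < 2 `^ q * C' :> R)%R by rewrite mulr_gt0// powR_gt0.
have eps0 : (0 < eps)%R by rewrite powR_gt0.
have e20 : (0 <= 2 * eps)%R by rewrite mulr_ge0// ltW.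
have epsE : ((2 * eps) `^ q * C' = eps)%R.
  rewrite powRM ?ltW// mulrAC -[X in (X * _)%R](powRr1 (ltW A0)) /eps -powRrM -powRD; last first.
    by apply/implyP => _; rewrite (gt_eqF A0).
  by congr (_ `^ _)%R; field; rewrite subr_eq0 gt_eqF.
split => //; exists eps => //.
pose u := fix u n : X -> \bar R :=
  if n is n'.+1 then fun x => operator K mu (fun y => u n' y `^ q) x + eps%:E * f x
  else fun=> 0.
have u0 n x : 0 <= u n x.
  elim: n x => // n IH x /=; apply: adde_ge0; last by rewrite mule_ge0// lee_fin ltW.
  by apply: operator_ge0 => y; exact: poweR_ge0.
have mpow (g : X -> \bar R) : measurable_fun [set: BX] g ->
    measurable_fun [set: BX] (fun y => g y `^ q).
  by move=> mg; exact: (measurableT_comp (measurable_poweR q) mg).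
have mu_ n : measurable_fun [set: BX] (u n).
  elim: n => [|n IH] /=; first exact: measurable_cst.
  apply: emeasurable_funD; last exact: measurable_funeM.
  by apply: measurable_operator => [|y]; [exact: mpow|exact: poweR_ge0].
have ndS n x : u n x <= u n.+1 x.
  elim: n x => [x|n IH x]; first exact: u0.
  rewrite /= leeD2r//; apply: le_operator => y; first exact: poweR_ge0.
  by apply: lee_poweR => //; exact: ltW.
have ndu x : {homo u ^~ x : n m / (n <= m)%N >-> n <= m}.
  by apply/nondecreasing_seqP => n; exact: ndS.
have bound n : {ae mu, forall x, u n x <= (2 * eps)%:E * f x}.
  elim: n => [|n IH].
    by apply: aeW => x; rewrite mule_ge0// lee_fin mulr_ge0// ltW.
  move: H; apply: ae_imp => x [Hx fx].
  have : operator K mu (fun y => u n y `^ q) x <=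
      ((2 * eps) `^ q)%:E * operator K mu (fun y => f y `^ q) x.
    rewrite -operatorZ//; last 3 first.
    - exact: mpow.
    - by move=> y; exact: poweR_ge0.
    - by rewrite lee_fin powR_ge0.
    apply: ae_ge0_le_integral => //.
    - by move=> y _; rewrite mule_ge0 ?poweR_ge0.
    - by apply: measurable_K_mul; exact: mpow.
    - by move=> y _; rewrite !mule_ge0 ?poweR_ge0// lee_fin powR_ge0.
    - by apply: measurable_K_mul; apply: measurable_funeM; exact: mpow.
    - move: IH; apply: ae_imp => y Hy _; rewrite lee_wpmul2l//.
      rewrite -poweR_EFin -poweRM ?lee_fin//.
      by apply: lee_poweR => //; exact: ltW.
  move=> h; rewrite /= (_ : (2 * eps)%:E = eps%:E + eps%:E); last first.
    by rewrite -EFinD -mulr2n mulr_natl.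
  rewrite ge0_muleDl ?lee_fin ?(ltW eps0)// leeD2r//.
  apply: (le_trans h); rewrite -{2}epsE EFinM -muleA lee_wpmul2l ?lee_fin ?powR_ge0//.
  apply: (le_trans Hx); rewrite lee_wpmul2r// lee_fin le_max lexx//.
pose U x := limn (u ^~ x).
have U0 x : 0 <= U x.
  by apply: lime_ge; [exact: ereal_nondecreasing_is_cvgn|exact: nearW].
have mU : measurable_fun [set: BX] U.
  apply: (@emeasurable_fun_cvg _ BX R setT u) => // x _.
  exact: ereal_nondecreasing_is_cvgn.
have UE x : U x = operator K mu (fun y => U y `^ q) x + eps%:E * f x.
  rewrite (_ : operator _ _ _ _ = limn (fun n => operator K mu (fun y => u n y `^ q) x)); last first.
    rewrite -operator_limn//.
    - by congr (operator K mu _ x); apply/funext => y; rewrite limn_poweR.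
    - by move=> n; exact: mpow.
    - by move=> n y; exact: poweR_ge0.
    - by move=> y n m nm; apply: lee_poweR => //; [exact: ltW|exact: ndu].
  set a := fun n => operator K mu _ x.
  have a0 n : 0 <= a n by apply: operator_ge0 => y; exact: poweR_ge0.
  have nda : {homo a : n m / (n <= m)%N >-> n <= m}.
    move=> n m nm; apply: le_operator => y; first exact: poweR_ge0.
    by apply: lee_poweR => //; [exact: ltW|exact: ndu].
  have cva := ereal_nondecreasing_is_cvgn nda.
  apply/cvg_lim => //; rewrite -cvg_shiftS.
  apply: cvgeD => //; last exact: cvg_cst.
  rewrite ge0_adde_def// inE; last by rewrite mule_ge0// lee_fin ltW.
  by apply: (lime_ge cva); exact: nearW.
have Ufin : {ae mu, forall x, U x \is a fin_num}.
  move: H (ae_foralln bound); apply: ae_imp2 => x [_ fx] bx.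
  rewrite ge0_fin_numE//; apply: (@le_lt_trans _ _ ((2 * eps)%:E * f x)).
    by apply: lime_le; [exact: ereal_nondecreasing_is_cvgn|exact: nearW].
  by rewrite lte_mul_pinfty// lee_fin mulr_ge0// ltW.
(* [U] may be infinite on a null set, where [fine] replaces it by [0]. *)
exists (fine \o U); split.
- exact: (measurableT_comp (fine_measurable (@measurableT _ (\bar R))) mU).
- by move=> x; exact: fine_ge0.
apply: (ae_imp _ Ufin) => x Ux /=; rewrite fineK// gee0_abs// {1}UE; congr (_ + _).
apply: ge0_ae_eq_integral => //.
- by apply: measurable_K_mul; exact: mpow.
- apply: measurable_K_mul; apply/measurable_EFinP.
  apply: (measurableT_comp (measurable_powR q)).
  exact: (measurableT_comp (fine_measurable (@measurableT _ (\bar R))) mU).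
- by move=> y _; rewrite mule_ge0 ?poweR_ge0.
- by move=> y _; rewrite mule_ge0// lee_fin powR_ge0.
by apply: (ae_imp _ Ufin) => y Uy _ /=; rewrite -poweR_EFin fineK.
Qed.

(** * Potentials of balls and of their complements *)
Definition low_potential mu x (a : R) : \bar R :=
  \int[lebesgue_measure]_(t in `]0%R, a[) (mu (qball x t) * invsq t).

Definition high_potential mu x (a : R) : \bar R :=
  \int[lebesgue_measure]_(t in `]a, +oo[) (mu (qball x t) * invsq t).

Lemma qballS x s t : (s <= t)%R -> qball x s `<=` qball x t.
Proof. by move=> st y /= /le_trans; apply. Qed.

Lemma le_mu_qball mu x s t : (s <= t)%R -> mu (qball x s) <= mu (qball x t).
Proof.
move=> st; apply: le_measure; rewrite ?inE; [exact: measurable_qball..|].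
exact: qballS.
Qed.

Lemma measurable_mu_qball mu x :
  measurable_fun setT (fun t : R => mu (qball x t)).
Proof. by apply: measurable_nondecreasing => s t st; exact: le_mu_qball. Qed.

Lemma mu_qball_invsq_ge0 mu x t : 0 <= mu (qball x t) * invsq t.
Proof. by rewrite mule_ge0 ?invsq_ge0. Qed.

Lemma measurable_mu_qball_invsq mu x :
  measurable_fun setT (fun t : R => mu (qball x t) * invsq t).
Proof. by apply: emeasurable_funM; [exact: measurable_mu_qball|exact: measurable_invsq]. Qed.

(** [high_potential mu x a] is [K mu (x)] with the kernel truncated at height
    [1 / a]. *)
Lemma high_potentialE mu x (a : R) : (0 <= a)%R ->
  high_potential mu x a = \int[mu]_z ((Num.max a (qdist x z))%:E)^-1.
Proof.
move=> a0; transitivity (\int[lebesgue_measure]_(t in `]a, +oo[)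
    ((\int[mu]_(y in [set y | (qdist x y <= t)%R]) 1) * invsq t)).
  apply: eq_integral => t _; rewrite integral_cst ?mul1e//.
  exact: (measurable_qball x t).
rewrite (@layer_cake R _ BX mu (qdist x) (fun=> 1) a (measurable_qdist x))//.
by apply: eq_integral => z _; rewrite mul1e.
Qed.

Lemma high_potential0 mu x : high_potential mu x 0 = potential K mu x.
Proof.
rewrite high_potentialE//; apply: eq_integral => z _.
by rewrite max_r// -K_qdist.
Qed.

Lemma high_potential_ge0 mu x a : 0 <= high_potential mu x a.
Proof. by apply: integral_ge0 => t _; exact: mu_qball_invsq_ge0. Qed.

Lemma low_potential_ge0 mu x a : 0 <= low_potential mu x a.
Proof. by apply: integral_ge0 => t _; exact: mu_qball_invsq_ge0. Qed.

#[local] Hint Resolve mu_qball_invsq_ge0 high_potential_ge0 low_potential_ge0 measurable_mu_qball_invsq : core.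

Lemma le_high_potential mu x s t : (s <= t)%R ->
  high_potential mu x t <= high_potential mu x s.
Proof.
move=> st; apply: ge0_integral_subset => // u.
- by rewrite /= !in_itv/= !andbT; exact: le_lt_trans.
- by move=> _; rewrite lexx andbT.
Qed.

Lemma potential_operator mu x : potential K mu x = operator K mu (fun=> 1) x.
Proof. by apply: eq_integral => y _; rewrite mule1. Qed.

Lemma potential_ge0 mu x : 0 <= potential K mu x.
Proof. by apply: integral_ge0 => y _. Qed.

Lemma measurable_potential mu : measurable_fun [set: BX] (potential K mu).
Proof.
rewrite (_ : potential K mu = operator K mu (fun=> 1)).
  exact: measurable_operator.
by apply/funext => x; exact: potential_operator.
Qed.

Lemma potential_inE mu (B : set BX) x :
  potential_in K mu B x = operator K mu (fun y => (\1_B y)%:E) x.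
Proof.
rewrite /potential_in integral_mkcond; apply: eq_integral => y _.
by rewrite patchE indicE; case: (y \in B); rewrite ?mule1 ?mule0.
Qed.

Lemma measurable_potential_in mu (B : set BX) : measurable B ->
  measurable_fun [set: BX] (potential_in K mu B).
Proof.
move=> mB; rewrite (_ : potential_in K mu B = operator K mu (fun y => (\1_B y)%:E)).
  by apply: measurable_operator => [|y]; [exact/measurable_EFinP/measurable_indic|rewrite lee_fin].
by apply/funext => x; exact: potential_inE.
Qed.

Lemma potential_in_ge0 mu (B : set BX) x : 0 <= potential_in K mu B x.
Proof. by apply: integral_ge0 => y _. Qed.

#[local] Hint Resolve potential_ge0 measurable_potential potential_in_ge0 : core.

Lemma operator_layer1 mu x (c : R) : (0 < c)%R ->
  \int[lebesgue_measure]_(t in `]0%R, +oo[) (mu (qball x (c * t)) * invsq t) =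
  c%:E * potential K mu x.
Proof.
move=> c0; rewrite potential_operator -operator_layer//.
by apply: eq_integral => t _; rewrite integral_cst ?mul1e//; exact: measurable_qball.
Qed.

Lemma measurable_inve_max x (t : R) : (0 < t)%R ->
  measurable_fun [set: BX] (fun z => ((Num.max t (qdist x z))%:E)^-1).
Proof.
move=> t0; have m0 z : (0 < Num.max t (qdist x z))%R by rewrite lt_max t0.
rewrite (_ : (fun _ => _) = fun z => ((Num.max t (qdist x z))^-1)%:E); last first.
  by apply/funext => z; rewrite inver gt_eqF.
apply/measurable_EFinP; apply: measurable_fun_invr_ge0; first by move=> z; exact: ltW.
by apply: measurable_maxr => //; exact: measurable_qdist.
Qed.

(** For [y] in [B_t(x)] and [z] outside [B_(2 kappa t)(x)], [rho(x,z)] is at most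
    [2 kappa rho(y,z)], so that the part of [mu] outside is seen from [y] much
    as from [x]. *)
Lemma potential_split mu x y (t : R) : (0 < t)%R -> qball x t y ->
  potential K mu y <= potential_in K mu (qball x (2 * kappa * t)) y +
                      (2 * kappa)%:E * high_potential mu x t.
Proof.
move=> t0 xy; have mB := measurable_qball x (2 * kappa * t).
rewrite /potential -(setUv (qball x (2 * kappa * t))).
rewrite (@ge0_integral_setU _ BX R mu _ _ mB (measurableC mB) (K y)); last 3 first.
- rewrite setUv; exact: measurable_K_section.
- by move=> z _; exact: K_ge0.
- by rewrite disj_set2E setICr.
rewrite leeD2l// high_potentialE ?(ltW t0)//.
have m0 z : (0 < Num.max t (qdist x z))%R by rewrite lt_max t0.
rewrite -ge0_integralZl//; last 3 first.
- exact: measurable_inve_max.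
- by move=> z _; apply: inve_fin_ge0; exact: ltW.
- by rewrite lee_fin ltW.
apply: ge0_integral_subset => // z.
  by rewrite mule_ge0 ?inve_fin_ge0 ?(ltW (m0 z))// lee_fin ltW.
move=> /negP; rewrite -ltNge => xz; rewrite K_ge0/= K_qdist.
have k0 := kappa_gt0; have q0 := qdist_ge0 y z.
have h : (qdist x z <= kappa * t + kappa * qdist y z)%R.
  by rewrite -mulrDr; apply: (le_trans (qdist_triangle x z y)); rewrite ler_pM2l// lerD2r.
have tq : (t <= qdist y z)%R by rewrite -(ler_pM2l k0); lra.
apply: lee_inve_scale; [exact: kappa2_gt0|exact: ltW|].
rewrite ge_max; apply/andP; split; last by lra.
by rewrite (le_trans tq)// ler_peMl// (le_trans kappa1)// ler_peMl ?ler1n// ltW.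
Qed.

(** * Testing implies the supersolution inequality *)

Section equivalence.
Variables (sigma omega : {sigma_finite_measure set BX -> \bar R}) (p q : R).
Hypothesis q1 : (1 < q)%R.
Hypothesis pq : (p^-1 + q^-1 = 1)%R.

Lemma infinitesimal_inequalityP : infinitesimal_inequality K sigma omega p q <->
  exists2 M : R, (0 < M)%R & forall x a, (0 < a)%R ->
    low_potential sigma x a * high_potential omega x a `^ (q - 1) <= M%:E.
Proof.
have E x a : (\int[lebesgue_measure]_(t in `]0%R, a[)
        (sigma (rho_ball K x t) * ((t ^+ 2)^-1)%:E)) *
    (\int[lebesgue_measure]_(t in `]a, +oo[)
        (omega (rho_ball K x t) * ((t ^+ 2)^-1)%:E)) `^ (q / p) =
    low_potential sigma x a * high_potential omega x a `^ (q - 1).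
  rewrite (conj_exponent q1 pq); congr (_ * _ `^ _);
    by apply: eq_integral => t _; rewrite rho_ball_qball.
split=> [|[M M0 H]]; rewrite /infinitesimal_inequality; last first.
  apply: (@le_lt_trans _ _ M%:E); last by rewrite ltry.
  by apply: ge_ereal_sup => _ [x [a [a0 ->]]]; rewrite E; exact: H.
set s := ereal_sup _ => sy.
have ub x a : (0 < a)%R ->
    low_potential sigma x a * high_potential omega x a `^ (q - 1) <= s.
  by move=> a0; rewrite -E; apply: ereal_sup_ubound; exists x, a.
have s0 : 0 <= s.
  apply: le_trans (ub point 1%R ltr01).
  by rewrite mule_ge0 ?poweR_ge0.
exists (fine s + 1)%R; first by rewrite ltr_wpDl// fine_ge0.
move=> x a a0; apply: (le_trans (ub x a a0)).
by rewrite EFinD fineK ?leeDl// ?lee_fin// ge0_fin_numE.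
Qed.

(** Tail powers for the density [omega (B_s(x)) / s^2] of [high_potential] and
    [r s = s]. *)
Lemma high_potential_poweR x (t : R) : (0 < t)%R ->
  high_potential omega x t `^ q <= 2%:E `^ q *
  \int[lebesgue_measure]_(s in `]t, +oo[)
    ((omega (qball x s) * invsq s) * high_potential omega x s `^ (q - 1)).
Proof.
move=> t0.
(* The radius, extended by [0] to negative [s] so as to be nonnegative everywhere. *)
pose r (s : R) : R := Num.max s 0%R.
have r0 s : (0 <= r s)%R by rewrite le_max lexx orbT.
have mr : measurable_fun setT r by exact: measurable_maxr.
have k0 s : 0 <= omega (qball x s) * invsq s by exact: mu_qball_invsq_ge0.
have := integral_tail_poweR lebesgue_measure (measurable_itv `]t, +oo[) mr
  (measurable_mu_qball_invsq omega x) r0 k0 (_ : (0 <= q - 1)%R).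
rewrite subrK subr_ge0 => /(_ (ltW q1)) /le_trans; apply.
rewrite lee_wpmul2l ?poweR_ge0//; apply: ge0_integral_mono => s.
  by move=> _; rewrite mule_ge0 ?poweR_ge0.
rewrite /= in_itv/= andbT => ts.
rewrite lee_wpmul2l//; apply: lee_poweR; first by rewrite subr_ge0 ltW.
  by apply: integral_ge0.
rewrite /high_potential integral_itv_obnd_cbnd; last first.
  by apply: measurable_funTS; exact: measurable_mu_qball_invsq.
apply: ge0_integral_subset => // [u [/=]|u _]; last by rewrite k0/=.
rewrite !in_itv/= !andbT /r => tu; rewrite !max_l// ltW//; exact: lt_trans t0 _.
Qed.

(** With [A] and [W] the low potential of [sigma] and the high potential of
    [omega] at [x]: bound [W(t)^q] by [high_potential_poweR] and exchange the
    integrals in [t < s].  The inner integral becomes [A(s)], and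
    [A(s) W(s)^(q-1) <= M] leaves [M] times the integral of
    [omega (B_s(x)) / s^2], which is [K omega (x)]. *)
Lemma low_high_potential (M : R) x : (0 <= M)%R ->
  (forall a, (0 < a)%R ->
    low_potential sigma x a * high_potential omega x a `^ (q - 1) <= M%:E) ->
  \int[lebesgue_measure]_(t in `]0%R, +oo[)
    ((sigma (qball x t) * invsq t) * high_potential omega x t `^ q) <=
  (2%:E `^ q * M%:E) * potential K omega x.
Proof.
move=> M0 HM.
pose ns (t : R) := sigma (qball x t) * invsq t.
pose nw (t : R) := omega (qball x t) * invsq t.
pose V (t : R) := high_potential omega x t `^ (q - 1).
have ns0 t : 0 <= ns t by exact: mu_qball_invsq_ge0.
have nw0 t : 0 <= nw t by exact: mu_qball_invsq_ge0.
have V0 t : 0 <= V t by exact: poweR_ge0.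
have mV : measurable_fun setT V.
  apply: (measurableT_comp (measurable_poweR (q - 1))).
  by apply: measurable_nonincreasing => s t st; exact: le_high_potential.
have mns : measurable_fun setT ns := measurable_mu_qball_invsq sigma x.
have mnw : measurable_fun setT nw := measurable_mu_qball_invsq omega x.
pose c2 : \bar R := 2%:E `^ q.
have c20 : 0 <= c2 by exact: poweR_ge0.
pose F (z : R * R) : \bar R := (c2 * (((0 < z.1)%R%:R)%:E * ns z.1)) *
  (((z.1 < z.2)%R%:R)%:E * (nw z.2 * V z.2)).
have ind0 (b : bool) : 0 <= (b%:R : R)%:E by rewrite lee_fin ler0n.
have F0 z : 0 <= F z by rewrite /F !mule_ge0 ?invsq_ge0.
have mF : measurable_fun setT F.
  apply: emeasurable_funM.
    apply: measurable_funeM; apply: emeasurable_funM.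
      by apply: measurable_ltr_nat => //; exact: measurable_fst.
    exact: measurableT_comp mns measurable_fst.
  apply: emeasurable_funM.
    by apply: measurable_ltr_nat.
  apply: emeasurable_funM; first exact: measurableT_comp mnw measurable_snd.
  exact: measurableT_comp mV measurable_snd.
have minner (t : R) : measurable_fun setT (fun s : R => ((t < s)%R%:R)%:E * (nw s * V s)).
  by apply: emeasurable_funM; [exact: measurable_ltr_nat|exact: emeasurable_funM].
apply: (@le_trans _ _ (\int[lebesgue_measure]_t \int[lebesgue_measure]_s F (t, s))).
  rewrite integral_itvoy; apply: ge0_integral_mono => t _.
    by rewrite !mule_ge0 ?poweR_ge0 ?invsq_ge0.
  rewrite /F/= ge0_integralZl//; last 3 first.
  - exact: minner.
  - by move=> s _; rewrite ?mule_ge0 ?invsq_ge0 ?poweR_ge0.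
  - by rewrite ?mule_ge0 ?invsq_ge0 ?poweR_ge0.
  case: (ltP 0%R t) => t0; last by rewrite !mul0e mule0 mul0e.
  rewrite !mul1e -integral_itvoy (muleC c2) -[leRHS]muleA lee_wpmul2l ?ns0//.
  exact: high_potential_poweR.
rewrite fubini_tonelli//.
apply: (@le_trans _ _ (\int[lebesgue_measure]_(s in `]0%R, +oo[) ((c2 * M%:E) * nw s))).
  rewrite [leRHS]integral_itvoy; apply: ge0_integral_mono => s _.
    by apply: integral_ge0.
  rewrite (_ : \int[lebesgue_measure]_t F (t, s) = \int[lebesgue_measure]_t
     ((c2 * (nw s * V s)) * ((((0 < t)%R && (t < s)%R)%:R)%:E * ns t))); last first.
    apply: eq_integral => t _; rewrite /F/=.
    case: (0 < t)%R; case: (t < s)%R => /=; rewrite ?(mul1e, mul0e, mule0)//.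
    exact: muleAC.
  rewrite ge0_integralZl//; last 3 first.
  - apply: emeasurable_funM => //.
    rewrite (_ : (fun _ => _) = fun t : R => (((0 < t)%R%:R)%:E * ((t < s)%R%:R)%:E)).
      by apply: emeasurable_funM; exact: measurable_ltr_nat.
    by apply/funext => t; case: (0 < t)%R; case: (t < s)%R; rewrite ?mul1e ?mul0e.
  - by move=> t _; rewrite ?mule_ge0 ?invsq_ge0 ?poweR_ge0.
  - by rewrite ?mule_ge0 ?invsq_ge0 ?poweR_ge0.
  rewrite -integral_set_bool.
  rewrite (_ : [set t | _] = `]0%R, s[%classic); last first.
    by apply/seteqP; split => t /=; rewrite in_itv.
  case: (ltP 0%R s) => s0; last first.
    by rewrite set_itv_ge ?integral_set0 ?mule0 ?mul0e// bnd_simp -leNgt.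
  rewrite mul1e (muleA c2) -(muleA (c2 * nw s)) (muleC (V s)) (muleAC c2 M%:E).
  by rewrite lee_wpmul2l ?(mule_ge0 c20 (nw0 s))//; exact: HM.
rewrite ge0_integralZl//; last 2 first.
- by apply: measurable_funTS; exact: mnw.
- by rewrite mule_ge0// lee_fin.
by rewrite -[in leRHS]high_potential0.
Qed.

Lemma testing_inequalityP : testing_inequality K sigma omega q ->
  exists2 C : R, (0 <= C)%R & forall x a, (0 < a)%R ->
    \int[sigma]_(z in qball x a) (potential_in K omega (qball x a) z `^ q) <=
    C%:E * omega (qball x a).
Proof.
move=> [C H]; exists (Num.max C 0%R); first by rewrite le_max lexx orbT.
move=> x a a0; have := H x a a0; rewrite /= rho_ball_qball => /le_trans; apply.
by rewrite lee_wpmul2r// lee_fin le_max lexx.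
Qed.

Section testing.
Variables M C : R.
Hypothesis M0 : (0 <= M)%R.
Hypothesis C0 : (0 <= C)%R.
Hypothesis inf_le : forall x a, (0 < a)%R ->
  low_potential sigma x a * high_potential omega x a `^ (q - 1) <= M%:E.
Hypothesis test_le : forall x a, (0 < a)%R ->
  \int[sigma]_(z in qball x a) (potential_in K omega (qball x a) z `^ q) <=
  C%:E * omega (qball x a).

(** By [potential_split], testing on [B_(2 kappa t)(x)] controls the near part of
    [K omega], and the far part is constant on [B_t(x)]. *)
Lemma testing_ball x (t : R) : (0 < t)%R ->
  \int[sigma]_(y in qball x t) (potential K omega y `^ q) <=
  2%:E `^ q * (C%:E * omega (qball x (2 * kappa * t)) +
    (2 * kappa)%:E `^ q * (sigma (qball x t) * high_potential omega x t `^ q)).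
Proof.
move=> t0; have q0 : (0 <= q)%R by rewrite ltW// (lt_trans ltr01).
have k2 := kappa2_gt0; have t2 : (0 < 2 * kappa * t)%R by rewrite mulr_gt0.
pose B := qball x (2 * kappa * t).
pose b := ((2 * kappa)%:E * high_potential omega x t) `^ q.
have mB : measurable B by exact: measurable_qball.
have mP : measurable_fun [set: BX] (fun y => potential_in K omega B y `^ q).
  exact: (measurableT_comp (measurable_poweR q) (measurable_potential_in omega mB)).
have mQ := measurable_qball x t.
apply: (@le_trans _ _ (\int[sigma]_(y in qball x t)
    (2%:E `^ q * (potential_in K omega B y `^ q + b)))).
  apply: ge0_integral_mono => y xy; first exact: poweR_ge0.
  apply: le_trans (poweRD_le _ _ _) => //.
    by apply: lee_poweR => //; exact: potential_split.
  by rewrite mule_ge0// lee_fin ltW.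
rewrite ge0_integralZl//; last 3 first.
- by apply: measurable_funTS; exact: emeasurable_funD.
- by move=> y _; rewrite adde_ge0 ?poweR_ge0.
- exact: poweR_ge0.
rewrite lee_wpmul2l ?poweR_ge0// ge0_integralD//; last 3 first.
- by move=> y _; exact: poweR_ge0.
- exact: measurable_funTS.
- by move=> y _; exact: poweR_ge0.
apply: leeD.
  apply: le_trans (test_le x t2).
  apply: ge0_integral_subset => // [|y _|y _]; last by rewrite poweR_ge0/=.
    by apply: qballS; rewrite ler_peMl ?(ltW t0)// (le_trans kappa1)// ler_peMl ?ler1n// ltW.
  exact: poweR_ge0.
rewrite integral_cst// /b poweRM ?lee_fin ?(ltW k2)//.
by rewrite -muleA lee_wpmul2l ?poweR_ge0// muleC.
Qed.

(** [testing_ball] integrated against [dt / t^2]: the near part gives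
    [2 kappa K omega (x)] up to a constant, by [operator_layer1], the far part is
    [low_high_potential]. *)
Lemma testing_pointwise : exists D : R, forall x,
  operator K sigma (fun y => potential K omega y `^ q) x <= D%:E * potential K omega x.
Proof.
have q0 : (0 <= q)%R by rewrite ltW// (lt_trans ltr01).
have k2 := kappa2_gt0.
exists ((2 `^ q * C * (2 * kappa) + 2 `^ q * (2 * kappa) `^ q * (2 `^ q * M))%R) => x.
have mf : measurable_fun [set: BX] (fun y => potential K omega y `^ q).
  exact: (measurableT_comp (measurable_poweR q) (measurable_potential omega)).
rewrite -[leLHS]mul1e -operator_layer//; last by move=> y; exact: poweR_ge0.
pose c1 : \bar R := (2 `^ q * C)%:E; pose c2 : \bar R := (2 `^ q * (2 * kappa) `^ q)%:E.
have c1E : c1 = 2%:E `^ q * C%:E by rewrite /c1 EFinM poweR_EFin.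
have c2E : c2 = 2%:E `^ q * (2 * kappa)%:E `^ q by rewrite /c2 EFinM !poweR_EFin.
have c10 : 0 <= c1 by rewrite lee_fin mulr_ge0 ?powR_ge0.
have c20 : 0 <= c2 by rewrite lee_fin mulr_ge0 ?powR_ge0.
pose f1 (t : R) := omega (qball x (2 * kappa * t)) * invsq t.
pose f2 (t : R) := (sigma (qball x t) * invsq t) * high_potential omega x t `^ q.
have f10 t : 0 <= f1 t by rewrite mule_ge0 ?invsq_ge0.
have f20 t : 0 <= f2 t by rewrite mule_ge0 ?poweR_ge0// mule_ge0 ?invsq_ge0.
have mf1 : measurable_fun setT f1.
  apply: emeasurable_funM; last exact: measurable_invsq.
  by apply: measurable_nondecreasing => s t st; apply: le_mu_qball; rewrite ler_pM2l.
have mf2 : measurable_fun setT f2.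
  apply: emeasurable_funM; first exact: measurable_mu_qball_invsq.
  apply: (measurableT_comp (measurable_poweR q)).
  by apply: measurable_nonincreasing => s t st; exact: le_high_potential.
apply: (@le_trans _ _ (\int[lebesgue_measure]_(t in `]0%R, +oo[) (c1 * f1 t + c2 * f2 t))).
  apply: ge0_integral_mono => t; rewrite /= in_itv/= andbT => t0.
    by rewrite mule_ge0 ?invsq_ge0// integral_ge0// => y _; exact: poweR_ge0.
  rewrite mul1r; apply: (le_trans (lee_wpmul2r (invsq_ge0 _) (testing_ball x t0))).
  rewrite -muleA ge0_muleDl ?mule_ge0 ?poweR_ge0 ?lee_fin//.
  rewrite ge0_muleDr ?mule_ge0 ?invsq_ge0 ?poweR_ge0 ?lee_fin//.
  rewrite c1E c2E /f1 /f2 -!muleA.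
  by rewrite (muleC (high_potential omega x t `^ q) (invsq t)).
rewrite ge0_integralD//; last 4 first.
- by move=> t _; rewrite mule_ge0.
- by apply: measurable_funTS; exact: measurable_funeM.
- by move=> t _; rewrite mule_ge0.
- by apply: measurable_funTS; exact: measurable_funeM.
rewrite ge0_integralZl//; last by apply: measurable_funTS.
rewrite ge0_integralZl//; last by apply: measurable_funTS.
rewrite operator_layer1// EFinD ge0_muleDl ?lee_fin; last 2 first.
- by rewrite !mulr_ge0 ?powR_ge0// ltW// kappa_gt0.
- by rewrite !mulr_ge0 ?powR_ge0.
apply: leeD; first by rewrite muleA -EFinM.
rewrite EFinM -muleA lee_wpmul2l//.
have := low_high_potential M0 (inf_le x).
by rewrite poweR_EFin -EFinM.
Qed.

(** If [W(a) = +oo], then [W(b) = +oo] for every [b >= a], since the kernels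
    truncated at [1 / a] and [1 / b] are comparable.  The infinitesimal
    inequality then forces [sigma (B_b(x)) = 0] for all these [b], and
    [sigma = 0]. *)
Lemma high_potential_fin x (a : R) : 0 < sigma setT -> (0 < a)%R ->
  high_potential omega x a < +oo.
Proof.
move=> s0 a0; rewrite ltey; apply/negP => /eqP Wa.
have Wb b : (a <= b)%R -> high_potential omega x b = +oo.
  move=> ab; have b0 : (0 < b)%R by exact: lt_le_trans ab.
  have : high_potential omega x a <= (b / a)%:E * high_potential omega x b.
    rewrite !high_potentialE ?(ltW a0) ?(ltW b0)//.
    have mx0 c z : (0 < c)%R -> (0 <= Num.max c (qdist x z))%R.
      by move=> c0; rewrite le_max ltW.
    rewrite -ge0_integralZl//; last 3 first.
    - exact: measurable_inve_max.
    - by move=> z _; apply: inve_fin_ge0; exact: mx0.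
    - by rewrite lee_fin divr_ge0 ?ltW.
    apply: ge0_integral_mono => z _; first by apply: inve_fin_ge0; exact: mx0.
    apply: lee_inve_scale; [by rewrite divr_gt0|exact: mx0|].
    have ba : (1 <= b / a)%R by rewrite ler_pdivlMr// mul1r.
    rewrite ge_max; apply/andP; split.
      by rewrite -{1}(divfK (lt0r_neq0 a0) b) ler_pM2l ?divr_gt0// le_max lexx.
    apply: (@le_trans _ _ (Num.max a (qdist x z))); first by rewrite le_max lexx orbT.
    by rewrite ler_peMl// mx0.
  rewrite Wa leye_eq => /eqP; case: (high_potential omega x b) (high_potential_ge0 omega x b) => //.
have Ab b : (a <= b)%R -> low_potential sigma x b = 0.
  move=> ab; have b0 : (0 < b)%R by exact: lt_le_trans ab.
  have := inf_le x b0; rewrite (Wb _ ab) poweRyr ?subr_eq0 ?gt_eqF//.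
  have := low_potential_ge0 sigma x b; rewrite le_eqVlt => /predU1P[<-//|h].
  by rewrite gt0_muley.
have Bb b : (a <= b)%R -> sigma (qball x b) = 0.
  move=> ab; have b0 : (0 < b)%R by exact: lt_le_trans ab.
  have b2 : (b < 2 * b)%R by rewrite ltr_pMl// ltr1n.
  have := Ab (2 * b)%R (ltW (le_lt_trans ab b2)).
  pose c : \bar R := (((2 * b) ^+ 2)^-1)%:E.
  have c0 : 0 < c by rewrite lte_fin invr_gt0 exprn_gt0// mulr_gt0.
  have : \int[lebesgue_measure]_(t in `]b, (2 * b)%R[) (sigma (qball x b) * c) <=
      low_potential sigma x (2 * b).
    apply: ge0_integral_subset => // t; rewrite /= !in_itv/=.
      by move=> /andP[bt ->]; rewrite (lt_trans b0 bt).
    move=> /andP[bt tb]; rewrite mule_ge0 ?(ltW c0)//=.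
    apply: lee_pmul => //; [exact: ltW|by apply: le_mu_qball; exact: ltW|].
    rewrite lee_fin lef_pV2 ?posrE ?exprn_gt0 ?mulr_gt0 ?(lt_trans b0 bt)//.
    by rewrite ler_pXn2r ?nnegrE ?(ltW tb)// ltW ?mulr_gt0 ?(lt_trans b0 bt).
  rewrite integral_cst//= lebesgue_measure_itv/= lte_fin b2 => + H; rewrite H.
  rewrite (_ : (2 * b)%:E - b%:E = b%:E); last by rewrite -EFinB mulr_natl mulr2n addrK.
  rewrite -muleA => h; apply/eqP; rewrite eq_le measure_ge0 andbT leNgt; apply/negP => h1.
  by move: h; rewrite leNgt mule_gt0// mule_gt0.
have : sigma setT <= 0.
  rewrite -[leLHS]mul1e -integral_cst//.
  rewrite (_ : setT = \bigcup_n qball x (a + n%:R)); last first.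
    apply/seteqP; split => // y _; exists (Num.truncn (qdist x y)).+1 => //=.
    by rewrite /qball/= ler_wpDl ?(ltW a0)// ltW// truncnS_gt.
  apply: integral_bigcup_le => //.
  - by move=> n m nm; apply: qballS; rewrite lerD2l ler_nat.
  - move=> n; rewrite integral_cst; last exact: measurable_qball.
    have := lexx (sigma (qball x (a + n%:R)%R)).
    by rewrite {2}Bb ?lerDl// mul1e.
by rewrite leNgt s0.
Qed.

Lemma mu_qball_high x (a : R) : (0 < a)%R ->
  omega (qball x a) <= a%:E * high_potential omega x a.
Proof.
move=> a0; rewrite high_potentialE ?(ltW a0)// -ge0_integralZl//; last 3 first.
- exact: measurable_inve_max.
- by move=> z _; apply: inve_fin_ge0; rewrite le_max ltW.
- by rewrite lee_fin ltW.
rewrite -[leLHS]mul1e -integral_cst; last exact: measurable_qball.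
apply: ge0_integral_subset => // z.
  by rewrite mule_ge0 ?lee_fin ?(ltW a0)// inve_fin_ge0// le_max ltW.
rewrite /qball/= => az; rewrite lee01/= max_l// inver gt_eqF// -EFinM.
by rewrite divff ?gt_eqF.
Qed.

(** On each ball [K omega] is bounded by its near part, which is finite almost
    everywhere by testing, and its far part, which is finite by
    [high_potential_fin]. *)
Lemma potential_ae_fin : {ae sigma, forall x, potential K omega x < +oo}.
Proof.
have q0 : (0 < q)%R by exact: lt_trans q1.
have k2 := kappa2_gt0.
have := measure_ge0 sigma setT; rewrite le_eqVlt => /predU1P[s0|s0].
  exists setT; split => //.
pose x : X := point.
suff H n : {ae sigma, forall y, qball x n.+1%:R y -> potential K omega y < +oo}.
  apply: (ae_imp _ (ae_foralln H)) => y /(_ (Num.truncn (qdist x y))); apply.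
  by rewrite /qball/= ltW// truncnS_gt.
have n0 : (0 < n.+1%:R :> R)%R by rewrite ltr0n.
pose t : R := (2 * kappa * n.+1%:R)%R.
have t0 : (0 < t)%R by rewrite mulr_gt0.
have mB : measurable (qball x t) by exact: measurable_qball.
have mP : measurable_fun [set: BX] (fun y => potential_in K omega (qball x t) y `^ q).
  exact: (measurableT_comp (measurable_poweR q) (measurable_potential_in omega mB)).
have intP : sigma.-integrable (qball x t)
    (fun y => potential_in K omega (qball x t) y `^ q).
  apply/integrableP; split; first exact: measurable_funTS.
  under eq_integral do rewrite gee0_abs ?poweR_ge0//.
  apply: (le_lt_trans (test_le x t0)).
  rewrite lte_mul_pinfty// (le_lt_trans (mu_qball_high x t0))//.
  by rewrite lte_mul_pinfty ?lee_fin ?(ltW t0)// high_potential_fin.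
apply: (ae_imp _ (integrable_ae mB intP)) => y Hy xy.
apply: (le_lt_trans (potential_split omega n0 xy)).
have ty : qball x t y.
  by apply: qballS xy; rewrite ler_peMl ?(ltW n0)// (le_trans kappa1)// ler_peMl ?ler1n// ltW.
rewrite lte_add_pinfty//; last first.
  by rewrite lte_mul_pinfty ?lee_fin ?(ltW k2)// high_potential_fin.
have := Hy ty; rewrite ge0_fin_numE ?poweR_ge0// => /lty_poweRy; apply.
by rewrite gt_eqF.
Qed.

End testing.

Lemma testing_supersolution : infinitesimal_inequality K sigma omega p q ->
  testing_inequality K sigma omega q ->
  exists C : R, {ae sigma, forall x : X,
    operator K sigma (fun y => potential K omega y `^ q) x <= C%:E * potential K omega x
    /\ potential K omega x < +oo}.
Proof.
move=> /infinitesimal_inequalityP[M M0 inf_le] /testing_inequalityP[C C0 test_le].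
have [D HD] := testing_pointwise (ltW M0) C0 inf_le test_le.
exists D; apply: (ae_imp _ (potential_ae_fin C0 inf_le test_le)) => x fx.
by split.
Qed.

(** * The norm inequality implies testing *)
Lemma mem_Lfun_ge0 (g : BX -> R) : measurable_fun setT g -> (forall x, (0 <= g x)%R) ->
  \int[sigma]_x ((g x)%:E `^ p) < +oo -> g \in Lfun sigma p%:E.
Proof.
move=> mg g0 gfin; rewrite inE; apply/andP; split; rewrite inE//=.
rewrite /finite_norm unlock; apply: poweR_lty.
rewrite (_ : \int[sigma]_x _ = \int[sigma]_x ((g x)%:E `^ p))//.
by apply: eq_integral => x _; rewrite /= ger0_norm.
Qed.

(** With [h = K omega_B] and [g = h^(q-1)] on [B], [int_B h^q dsigma] is
    [int g h dsigma], hence at most [c int_B K g domega] by Tonelli up to a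
    constant.  By Young's inequality and the norm inequality this is at most
    [J / 2 + C omega(B)] with [J = int g^p dsigma = int_B h^q dsigma], as
    [(q - 1) p = q].  To absorb [J], [h] is first truncated at height [n] and [B]
    to sets of finite measure, so that [J] is finite. *)
Lemma weighted_norm_testing : weighted_norm_inequality K sigma omega p ->
  testing_inequality K sigma omega q.
Proof.
move=> [C0 HC0]; have p1 := (p_gt1 q1 pq); have p0 : (0 < p)%R by exact: lt_trans p1.
have q0 : (0 < q)%R by exact: lt_trans q1.
pose C : R := Num.max C0 1%R.
have C1 : (0 < C)%R by rewrite lt_max ltr01 orbT.
have HC (g : BX -> R) : g \in Lfun sigma p%:E -> (forall x, (0 <= g x)%R) ->
    \int[omega]_x (operator K sigma (EFin \o g) x `^ p) <=
    C%:E * \int[sigma]_x ((g x)%:E `^ p).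
  move=> gL g0; apply: (le_trans (HC0 g gL g0)); rewrite lee_wpmul2r//.
    by apply: integral_ge0 => x _; exact: poweR_ge0.
  by rewrite lee_fin le_max lexx.
pose c : R := (20 * kappa ^+ 3)%R.
have c0 : (0 < c)%R by rewrite mulr_gt0// exprn_gt0// kappa_gt0.
(* The weight in Young's inequality for which [c d^p C = 1 / 2]. *)
pose d : R := ((2 * (c * C)) `^ (- p^-1))%R.
have A0 : (0 < 2 * (c * C))%R by rewrite !mulr_gt0.
have d0 : (0 < d)%R by exact: powR_gt0.
have dE : (c * (d `^ p) * C = 2^-1)%R.
  rewrite /d -powRrM mulNr mulVf ?gt_eqF// powR_inv1 ?(ltW A0)//.
  by field; rewrite !gt_eqF// ltW.
exists (2 * (c * d `^ (- q)))%R => x a a0; rewrite /= rho_ball_qball.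
set B := qball x a; have mB : measurable B by exact: measurable_qball.
set M := (X in _ <= X).
set h := potential_in K omega B.
have mh : measurable_fun [set: BX] h by exact: measurable_potential_in.
have h0 y : 0 <= h y by exact: potential_in_ge0.
apply: integral_truncate_le => // n.
have /sigma_finiteP[E [E_T E_nd E_oo]] := sigma_finiteT sigma.
pose D m := B `&` E m.
have mD m : measurable (D m) by apply: measurableI => //; exact: (E_oo m).1.
have -> : B = \bigcup_m D m by rewrite -setI_bigcupr -E_T setIT.
pose hn y := Order.min (h y) n%:R%:E.
have hn0 y : 0 <= hn y by rewrite le_min h0 lee_fin ler0n.
have hnn y : hn y <= n%:R%:E by rewrite ge_min lexx orbT.
have hnfin y : hn y \is a fin_num by rewrite ge0_fin_numE// (le_lt_trans (hnn y))// ltry.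
have mhn : measurable_fun [set: BX] hn by exact: measurable_mine.
have mhnq : measurable_fun [set: BX] (fun y => hn y `^ q).
  exact: (measurableT_comp (measurable_poweR q) mhn).
apply: integral_bigcup_le => //.
- by move=> i j ij; apply: setIS; apply/subsetPset/E_nd.
- by move=> y; exact: poweR_ge0.
move=> m; pose g y : R := (fine (hn y) `^ (q - 1) * \1_(D m) y)%R.
have g0 y : (0 <= g y)%R by rewrite mulr_ge0// powR_ge0.
have mg : measurable_fun [set: BX] g.
  apply: measurable_funM; last exact: measurable_indic.
  apply: (measurableT_comp (measurable_powR (q - 1))).
  exact: (measurableT_comp (fine_measurable (@measurableT _ (\bar R))) mhn).
set J := \int[sigma]_(y in D m) _.
have gE y : (g y)%:E = hn y `^ (q - 1) * (\1_(D m) y)%:E.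
  by rewrite /g EFinM -poweR_EFin fineK.
have gpE : \int[sigma]_y ((g y)%:E `^ p) = J.
  rewrite /J [RHS]integral_mkcond; apply: eq_integral => y _.
  rewrite gE patchE indicE; case: (y \in D m).
    by rewrite mule1 -poweRrM (mul_conj_exponent q1 pq).
  by rewrite mule0 poweR0r// gt_eqF.
have Jfin : J < +oo.
  apply: (@le_lt_trans _ _ (\int[sigma]_(y in D m) (n%:R%:E `^ q))).
    apply: ge0_integral_mono => y _; first exact: poweR_ge0.
    by apply: lee_poweR; [exact: ltW|exact: hn0|exact: hnn].
  rewrite integral_cst//; rewrite lte_mul_pinfty ?lee_fin ?powR_ge0//.
  apply: le_lt_trans (E_oo m).2; apply: le_measure; rewrite ?inE//.
    exact: (E_oo m).1.
  by move=> y [].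
have J0 : 0 <= J by apply: integral_ge0 => y _; exact: poweR_ge0.
have gL : g \in Lfun sigma p%:E by apply: mem_Lfun_ge0 => //; rewrite gpE.
pose T := operator K sigma (EFin \o g).
have T0 y : 0 <= T y by apply: operator_ge0 => z; rewrite lee_fin.
have mT : measurable_fun [set: BX] T.
  by apply: measurable_operator => [|z]; [exact/measurable_EFinP|rewrite lee_fin].
have step : J <= c%:E * \int[omega]_x ((\1_B x)%:E * T x).
  have := @tonelli_operator omega sigma (fun y => (\1_B y)%:E) (EFin \o g).
  have mi : measurable_fun [set: BX] (fun y => (\1_B y : R)%:E).
    exact/measurable_EFinP/measurable_indic.
  have meg : measurable_fun [set: BX] (EFin \o g) by exact/measurable_EFinP.
  move=> /(_ mi meg).
  have i0 y : 0 <= (\1_B y : R)%:E by rewrite lee_fin.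
  have eg0 y : 0 <= (EFin \o g) y by rewrite lee_fin.
  move=> /(_ i0 eg0); apply: le_trans.
  rewrite /J integral_mkcond; apply: ge0_integral_mono => y _.
    by rewrite patchE; case: ifPn => // _; exact: poweR_ge0.
  rewrite patchE /= gE indicE; case: ifPn => [yD|_]; last first.
    by rewrite mule0 mul0e.
  rewrite mule1 -potential_inE -/(h y).
  rewrite (_ : hn y `^ q = hn y `^ (q - 1) * hn y); last first.
    have v0 : (0 <= fine (hn y))%R by exact: fine_ge0.
    by rewrite -(fineK (hnfin y)) !poweR_EFin -EFinM mulrC mulr_powRB1.
  by rewrite lee_wpmul2l ?poweR_ge0// ge_min lexx.
have young : \int[omega]_x ((\1_B x)%:E * T x) <=
    (d `^ p)%:E * (C%:E * J) + (d `^ (- q))%:E * omega B.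
  have mTp : measurable_fun [set: BX] (fun y => T y `^ p).
    exact: (measurableT_comp (measurable_poweR p) mT).
  apply: (@le_trans _ _ (\int[omega]_x ((d `^ p)%:E * T x `^ p + (d `^ (- q))%:E * (\1_B x)%:E))).
    apply: ge0_integral_mono => y _; first by rewrite mule_ge0// lee_fin.
    rewrite muleC; apply: (le_trans (lee_mul_Young q1 pq d0 _ _)) => //.
    rewrite leeD2l// lee_wpmul2l ?lee_fin ?powR_ge0//.
    by rewrite indicE; case: (y \in B); rewrite ?powR1// powR0// gt_eqF.
  rewrite ge0_integralD//; last 4 first.
  - by move=> y _; rewrite mule_ge0 ?lee_fin ?powR_ge0// poweR_ge0.
  - exact: measurable_funeM.
  - by move=> y _; rewrite mule_ge0 ?lee_fin ?powR_ge0.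
  - by apply: measurable_funeM; exact/measurable_EFinP/measurable_indic.
  apply: leeD.
    rewrite ge0_integralZl// ?lee_fin ?powR_ge0//; last by move=> y _; exact: poweR_ge0.
    by rewrite lee_wpmul2l ?lee_fin ?powR_ge0// -gpE; exact: HC.
  rewrite ge0_integralZl ?lee_fin ?powR_ge0//.
  - by rewrite integral_indic// setIT.
  - exact/measurable_EFinP/measurable_indic.
have : J <= (2^-1)%:E * J + (c * d `^ (- q))%:E * omega B.
  apply: (le_trans step); apply: (le_trans (lee_wpmul2l _ young)).
    by rewrite lee_fin ltW.
  rewrite ge0_muleDr; last 2 first.
  - by rewrite !mule_ge0 ?lee_fin ?powR_ge0// ltW.
  - by rewrite mule_ge0 ?lee_fin ?powR_ge0.
  by rewrite !muleA -!EFinM dE.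
rewrite /M -(fineK (_ : J \is a fin_num)) ?ge0_fin_numE//.
have [omfin|] := boolP (omega B \is a fin_num); last first.
  rewrite ge0_fin_numE// -leNgt leye_eq => /eqP ->.
  by move=> _; rewrite gt0_muley ?leey// lte_fin !mulr_gt0// powR_gt0.
rewrite -(fineK omfin) -!EFinM -EFinD !lee_fin; lra.
Qed.

(** * A solution implies the norm inequality *)
Definition schur_const : R :=
  (2 `^ p * (2 * kappa) `^ (p - 1) * (20 * kappa ^+ 3))%R.

Lemma schur_const_gt0 : (0 < schur_const)%R.
Proof.
have k0 := kappa_gt0; have k2 := kappa2_gt0.
by rewrite /schur_const !mulr_gt0 ?powR_gt0// exprn_gt0.
Qed.

(** [operator_poweR] with [t = p - 1] replaces [(K g)^p] by [K(g (K g)^(p-1))],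
    and Tonelli up to a constant moves [K] onto [h nu]. *)
Lemma operator_schur nu (g h : X -> \bar R) :
  measurable_fun [set: BX] g -> measurable_fun [set: BX] h ->
  (forall y, 0 <= g y) -> (forall y, 0 <= h y) ->
  \int[nu]_x (h x * (operator K sigma g x) `^ p) <=
  schur_const%:E * \int[sigma]_y
    ((g y * (operator K sigma g y) `^ (p - 1)) * operator K nu h y).
Proof.
move=> mg mh g0 h0; have p1 := (p_gt1 q1 pq).
have t0 : (0 <= p - 1)%R by rewrite subr_ge0 ltW.
set T := operator K sigma g.
have mT : measurable_fun [set: BX] T by exact: measurable_operator.
have T0 y : 0 <= T y by exact: operator_ge0.
pose g' y := g y * T y `^ (p - 1).
have g'0 y : 0 <= g' y by rewrite mule_ge0 ?poweR_ge0.
have mg' : measurable_fun [set: BX] g'.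
  apply: emeasurable_funM => //.
  exact: (measurableT_comp (measurable_poweR (p - 1)) mT).
pose c1 : \bar R := (2 `^ p * (2 * kappa) `^ (p - 1))%:E.
have c10 : 0 <= c1 by rewrite lee_fin mulr_ge0 ?powR_ge0.
have mKg' := @measurable_operator sigma g' mg' g'0.
apply: (@le_trans _ _ (\int[nu]_x (c1 * (h x * operator K sigma g' x)))).
  apply: ge0_integral_mono => x _; first by rewrite mule_ge0 ?poweR_ge0.
  rewrite muleCA lee_wpmul2l//.
  have := @operator_poweR sigma g (p - 1) x mg g0 t0.
  by rewrite subrK !poweR_EFin -EFinM.
rewrite ge0_integralZl//; last 2 first.
- exact: emeasurable_funM.
- by move=> x _; rewrite mule_ge0// operator_ge0.
rewrite /schur_const EFinM -/c1 -muleA lee_wpmul2l//.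
exact: tonelli_operator.
Qed.

Section from_solution.
Variables (eps : R) (u : BX -> R).
Hypothesis eps0 : (0 < eps)%R.
Hypothesis measurable_u : measurable_fun setT u.
Hypothesis u0 : forall x, (0 <= u x)%R.
Hypothesis Ku_le : {ae sigma, forall x, operator K sigma (fun y => (u y)%:E `^ q) x <= (u x)%:E}.
Hypothesis omega_le : {ae sigma, forall x, eps%:E * potential K omega x <= (u x)%:E}.

Lemma potential_gt0 x : 0 < omega setT -> 0 < potential K omega x.
Proof.
move=> om0; rewrite lt_neqAle potential_ge0 andbT; apply/eqP => f0.
have B0 n : omega (qball x n.+1%:R) <= 0.
  have n0 : (0 < n.+1%:R :> R)%R by rewrite ltr0n.
  apply: (le_trans (mu_qball_high x n0)).
  have : high_potential omega x n.+1%:R <= 0.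
    by rewrite f0 -high_potential0; apply: le_high_potential; exact: ltW.
  move=> h; rewrite (_ : high_potential _ _ _ = 0) ?mule0//.
  by apply/eqP; rewrite eq_le h high_potential_ge0.
move: om0; rewrite ltNge => /negP; apply.
rewrite -[leLHS]mul1e -integral_cst//.
rewrite (_ : setT = \bigcup_n qball x n.+1%:R); last first.
  apply/seteqP; split => // y _; exists (Num.truncn (qdist x y)) => //=.
  by rewrite /qball/= ltW// truncnS_gt.
apply: integral_bigcup_le => //.
- by move=> n m nm; apply: qballS; rewrite ler_nat ltnS.
- move=> n; rewrite integral_cst; last exact: measurable_qball.
  by rewrite mul1e; exact: B0.
Qed.

(** [g] is restricted to a set [G] of finite measure where [u <= n] and
    [g <= n u^q], so that the energy [I] is finite and can be absorbed; the
    bounds obtained do not depend on [n]. *)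
Section truncated.
Variables (g : BX -> R) (G : set BX) (n : R).
Hypothesis n0 : (0 <= n)%R.
Hypothesis mg : measurable_fun setT g.
Hypothesis g0 : forall x, (0 <= g x)%R.
Hypothesis mG : measurable G.
Hypothesis G_fin : sigma G < +oo.
Hypothesis G_u : forall y, G y -> (u y <= n)%R.
Hypothesis G_g : forall y, G y -> (g y <= n * u y `^ q)%R.

Let gG y : \bar R := (g y * \1_G y)%:E.
Let T := operator K sigma gG.
Let I := \int[sigma]_y (((u y `^ q * \1_G y)%R)%:E * T y `^ p).

Let hG y : \bar R := ((u y `^ q * \1_G y)%R)%:E.

Lemma gG_ge0 y : 0 <= gG y. Proof. by rewrite lee_fin mulr_ge0. Qed.

Lemma hG_ge0 y : 0 <= hG y. Proof. by rewrite lee_fin mulr_ge0 ?powR_ge0. Qed.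

Lemma measurable_gG : measurable_fun [set: BX] gG.
Proof. by apply/measurable_EFinP; apply: measurable_funM => //; exact: measurable_indic. Qed.

Lemma measurable_uq : measurable_fun [set: BX] (fun y => (u y)%:E `^ q).
Proof.
apply: (measurableT_comp (measurable_poweR q)).
exact/measurable_EFinP.
Qed.

Lemma measurable_hG : measurable_fun [set: BX] hG.
Proof.
apply/measurable_EFinP; apply: measurable_funM; last exact: measurable_indic.
exact: (measurableT_comp (measurable_powR q)).
Qed.

Lemma T_ge0 y : 0 <= T y. Proof. exact/operator_ge0/gG_ge0. Qed.

Lemma measurable_T : measurable_fun [set: BX] T.
Proof. by apply: measurable_operator; [exact: measurable_gG|exact: gG_ge0]. Qed.

Lemma truncated_operator_le : {ae sigma, forall y, T y <= n%:E * (u y)%:E}.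
Proof.
apply: (ae_imp _ Ku_le) => y Hy.
apply: (@le_trans _ _ (n%:E * operator K sigma (fun y => (u y)%:E `^ q) y)); last first.
  by rewrite lee_wpmul2l ?lee_fin.
rewrite -operatorZ; [|exact: measurable_uq|by move=> z; exact: poweR_ge0|by rewrite lee_fin].
apply: le_operator => z; first exact: gG_ge0.
rewrite poweR_EFin -EFinM /gG lee_fin indicE.
case: (boolP (z \in G)) => [/set_mem Gz|_].
  by rewrite mulr1 G_g.
by rewrite mulr0 mulr_ge0 ?powR_ge0.
Qed.

(** On [G], [T <= n K u^q <= n u <= n^2]. *)
Lemma energy_fin : I < +oo.
Proof.
have p0 : (0 < p)%R by rewrite (lt_trans ltr01)// (p_gt1 q1 pq).
pose c : R := (n `^ q * (n * n) `^ p)%R.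
have c0 : (0 <= c)%R by rewrite mulr_ge0 ?powR_ge0.
apply: (@le_lt_trans _ _ (\int[sigma]_y (c%:E * (\1_G y)%:E))).
  apply: ae_ge0_le_integral => //.
  - by move=> y _; rewrite mule_ge0 ?hG_ge0 ?poweR_ge0.
  - apply: emeasurable_funM; first exact: measurable_hG.
    by apply: (measurableT_comp (measurable_poweR p)); exact: measurable_T.
  - by move=> y _; rewrite -EFinM lee_fin mulr_ge0.
  - apply: measurable_funeM; apply/measurable_EFinP; exact: measurable_indic.
  apply: (ae_imp _ truncated_operator_le) => y Ty _; rewrite indicE.
  case: (boolP (y \in G)) => [/set_mem Gy|_]; last by rewrite !mulr0 mul0e mule0.
  rewrite mulr1 mule1 /c EFinM; apply: lee_pmul => //.
  - by rewrite lee_fin powR_ge0.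
  - exact: poweR_ge0.
  - by rewrite lee_fin; apply: ge0_ler_powR; rewrite ?nnegrE ?(ltW (lt_trans ltr01 q1))// G_u.
  rewrite -poweR_EFin; apply: lee_poweR; [exact: ltW|exact: T_ge0|].
  by apply: (le_trans Ty); rewrite -EFinM lee_fin ler_wpM2l// G_u.
rewrite ge0_integralZl//.
- by rewrite integral_indic// setIT lte_mul_pinfty.
- by apply/measurable_EFinP; exact: measurable_indic.
Qed.

Let gpow := \int[sigma]_y ((g y)%:E `^ p).

(** Young's inequality for [g] and [T^(p-1) u], whose [q]-th power is [u^q T^p]
    because [(p - 1) q = p]. *)
Lemma energy_Young (d : R) : (0 < d)%R ->
  \int[sigma]_y ((gG y * T y `^ (p - 1)) * (u y)%:E) <=
  (d `^ p)%:E * gpow + (d `^ (- q))%:E * I.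
Proof.
move=> d0; have p1 := (p_gt1 q1 pq); have p0 : (0 < p)%R by exact: lt_trans p1.
have q0 : (0 < q)%R by exact: lt_trans q1.
have mgp : measurable_fun [set: BX] (fun y => (g y)%:E `^ p).
  by apply: (measurableT_comp (measurable_poweR p)); exact/measurable_EFinP.
have mI : measurable_fun [set: BX] (fun y => hG y * T y `^ p).
  apply: emeasurable_funM; first exact: measurable_hG.
  by apply: (measurableT_comp (measurable_poweR p)); exact: measurable_T.
have I0 y : 0 <= hG y * T y `^ p by rewrite mule_ge0 ?hG_ge0 ?poweR_ge0.
apply: (@le_trans _ _ (\int[sigma]_y ((d `^ p)%:E * (g y)%:E `^ p +
    (d `^ (- q))%:E * (hG y * T y `^ p)))).
  apply: ge0_integral_mono => y _.
    by rewrite !mule_ge0 ?gG_ge0 ?poweR_ge0// lee_fin.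
  rewrite /gG /hG indicE; case: (boolP (y \in G)) => _; last first.
    by rewrite !mulr0 !mul0e mule0 adde0 mule_ge0 ?poweR_ge0// lee_fin powR_ge0.
  rewrite !mulr1 -muleA.
  have b0 : 0 <= T y `^ (p - 1) * (u y)%:E by rewrite mule_ge0 ?poweR_ge0// lee_fin.
  have ge0 : 0 <= (g y)%:E by rewrite lee_fin.
  apply: (le_trans (lee_mul_Young q1 pq d0 ge0 b0)); rewrite leeD2l// lee_wpmul2l ?lee_fin ?powR_ge0//.
  rewrite poweRM ?poweR_ge0 ?lee_fin// -poweRrM.
  rewrite (mul_conj_exponentC q1 pq).
  by rewrite poweR_EFin muleC.
rewrite ge0_integralD//; last 4 first.
- by move=> y _; rewrite mule_ge0 ?poweR_ge0// lee_fin powR_ge0.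
- exact: measurable_funeM.
- by move=> y _; rewrite mule_ge0 ?lee_fin ?powR_ge0.
- exact: measurable_funeM.
rewrite ge0_integralZl ?lee_fin ?powR_ge0//; last by move=> y _; exact: poweR_ge0.
by rewrite ge0_integralZl ?lee_fin ?powR_ge0.
Qed.

(** Used twice: for [h nu = u^q sigma] on [G], where the left-hand side is the
    energy, and for [h nu = omega], where it is the norm to be bounded. *)
Lemma integral_schur_supersolution nu (h : X -> \bar R) (c : R) : (0 < c)%R ->
  measurable_fun [set: BX] h -> (forall y, 0 <= h y) ->
  {ae sigma, forall y, operator K nu h y <= c%:E * (u y)%:E} ->
  \int[nu]_x (h x * T x `^ p) <=
  (schur_const * c)%:E * \int[sigma]_y ((gG y * T y `^ (p - 1)) * (u y)%:E).
Proof.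
move=> c0 mh h0 Kh.
have mgT : measurable_fun [set: BX] (fun y => gG y * T y `^ (p - 1)).
  apply: emeasurable_funM; first exact: measurable_gG.
  by apply: (measurableT_comp (measurable_poweR (p - 1))); exact: measurable_T.
have gT0 y : 0 <= gG y * T y `^ (p - 1) by rewrite mule_ge0 ?gG_ge0 ?poweR_ge0.
have mU : measurable_fun [set: BX] (fun y => (u y)%:E) by exact/measurable_EFinP.
have S0 := schur_const_gt0.
apply: (le_trans (operator_schur nu measurable_gG mh gG_ge0 h0)).
rewrite [(schur_const * c)%:E]EFinM -[leRHS]muleA lee_wpmul2l ?lee_fin ?(ltW S0)//.
rewrite -ge0_integralZl//; last 3 first.
- exact: emeasurable_funM.
- by move=> y _; rewrite mule_ge0// lee_fin.
- by rewrite lee_fin ltW.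
apply: ae_ge0_le_integral => //.
- by move=> y _; rewrite mule_ge0// operator_ge0.
- by apply: emeasurable_funM => //; exact: measurable_operator.
- by move=> y _; rewrite !mule_ge0 ?gG_ge0 ?poweR_ge0// lee_fin// ltW.
- by apply: measurable_funeM; exact: emeasurable_funM.
apply: (ae_imp _ Kh) => y Hy _.
by rewrite muleCA lee_wpmul2l.
Qed.

Definition norm_const : R :=
  (2 * (schur_const * ((2 * schur_const) `^ q^-1) `^ p))%R.

Lemma norm_const_ge0 : (0 <= norm_const)%R.
Proof. by rewrite !mulr_ge0 ?powR_ge0// ltW// schur_const_gt0. Qed.

Lemma gpow_ge0 : 0 <= gpow.
Proof. by apply: integral_ge0 => y _; exact: poweR_ge0. Qed.

Lemma energy_ge0 : 0 <= I.
Proof. by apply: integral_ge0 => y _; rewrite mule_ge0 ?hG_ge0 ?poweR_ge0. Qed.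

(** The energy is at most [schur_const] times the integral in [energy_Young],
    since [K u^q <= u]; with [schur_const * d^(-q) = 1 / 2] half of it is
    absorbed. *)
Lemma energy_le : I <= norm_const%:E * gpow.
Proof.
have S0 := schur_const_gt0; have q0 : (0 < q)%R by exact: lt_trans q1.
pose d : R := ((2 * schur_const) `^ q^-1)%R.
have A0 : (0 < 2 * schur_const)%R by rewrite mulr_gt0.
have d0 : (0 < d)%R by exact: powR_gt0.
have dE : (schur_const * d `^ (- q) = 2^-1)%R.
  rewrite /d -powRrM mulrN mulVf ?gt_eqF// powR_inv1 ?(ltW A0)//.
  by field; rewrite gt_eqF.
have Kh : {ae sigma, forall y, operator K sigma hG y <= 1%:E * (u y)%:E}.
  apply: (ae_imp _ Ku_le) => y; rewrite mul1e; apply: le_trans.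
  apply: le_operator => z; first exact: hG_ge0.
  by rewrite poweR_EFin lee_fin ler_piMr ?powR_ge0// indicE; case: (_ \in _).
have := integral_schur_supersolution ltr01 measurable_hG hG_ge0 Kh.
rewrite mulr1 -/I => h1.
have : I <= (schur_const * d `^ p)%:E * gpow + (2^-1)%:E * I.
  apply: (le_trans h1).
  apply: (le_trans (lee_wpmul2l _ (energy_Young d0))); first by rewrite lee_fin ltW.
  rewrite ge0_muleDr; last 2 first.
  - by rewrite mule_ge0 ?gpow_ge0// lee_fin powR_ge0.
  - by rewrite mule_ge0 ?energy_ge0// lee_fin powR_ge0.
  by rewrite !muleA -!EFinM dE.
have Ifin : I \is a fin_num by rewrite ge0_fin_numE ?energy_ge0// energy_fin.
have [gfin|] := boolP (gpow \is a fin_num); last first.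
  rewrite ge0_fin_numE ?gpow_ge0// -leNgt leye_eq => /eqP -> _.
  by rewrite gt0_muley ?leey// lte_fin !mulr_gt0// powR_gt0.
rewrite -(fineK Ifin) -(fineK gfin) -!EFinM -EFinD !lee_fin /norm_const -/d.
set a := fine I; set b := (schur_const * d `^ p)%R; set e := fine gpow => h.
rewrite -mulrA -/b.
by move: h; lra.
Qed.

Lemma omega_energy_le : \int[omega]_x (T x `^ p) <=
  (schur_const * eps^-1 * (1 + norm_const))%:E * gpow.
Proof.
have S0 := schur_const_gt0.
have e0 : (0 < eps^-1)%R by rewrite invr_gt0.
have Kh : {ae sigma, forall y, operator K omega (fun=> 1) y <= (eps^-1)%:E * (u y)%:E}.
  apply: (ae_imp _ omega_le) => y; rewrite -potential_operator => h.
  rewrite (_ : potential K omega y = (eps^-1)%:E * (eps%:E * potential K omega y)).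
    by rewrite lee_wpmul2l// lee_fin ltW.
  by rewrite muleA -EFinM mulVf ?gt_eqF// mul1e.
have := integral_schur_supersolution e0 (@measurable_cst _ _ _ _ _ _) (fun=> lee01) Kh.
rewrite (eq_integral (fun x : BX => T x `^ p)); last by move=> x _; rewrite mul1e.
move/le_trans; apply; rewrite [X in _ <= X * _]EFinM -muleA.
have SE := mulr_ge0 (ltW S0) (ltW e0).
rewrite lee_wpmul2l ?lee_fin//.
apply: (le_trans (energy_Young ltr01)); rewrite !powR1 !mul1e.
rewrite EFinD ge0_muleDl ?lee_fin ?norm_const_ge0// mul1e leeD2l//.
exact: energy_le.
Qed.

End truncated.

(** Unless [omega = 0], [u >= eps K omega > 0] almost everywhere, so that the sets
    [G n] below exhaust [X] up to a [sigma]-null set. *)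
Lemma solution_norm : weighted_norm_inequality K sigma omega p.
Proof.
have S0 := schur_const_gt0; have p1 := (p_gt1 q1 pq); have p0 : (0 < p)%R by exact: lt_trans p1.
have e0 : (0 < eps^-1)%R by rewrite invr_gt0.
exists (schur_const * eps^-1 * (1 + norm_const))%R => g gL g0.
have mg : measurable_fun setT g by move: gL; rewrite inE => /andP[]; rewrite inE.
set M := (X in _ <= X).
have M0 : 0 <= M.
  apply: mule_ge0.
    rewrite lee_fin; apply: mulr_ge0; first exact: mulr_ge0 (ltW S0) (ltW e0).
    exact: addr_ge0 ler01 norm_const_ge0.
  by apply: integral_ge0 => x _; exact: poweR_ge0.
have mgE : measurable_fun [set: BX] (EFin \o g) by exact/measurable_EFinP.
have gE0 y : 0 <= (EFin \o g) y by rewrite lee_fin.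
have := measure_ge0 omega setT; rewrite le_eqVlt => /predU1P[om0|om0].
  rewrite null_set_integral//.
  apply: (measurableT_comp (measurable_poweR p)); exact: measurable_operator.
have u_gt0 : {ae sigma, forall y, (0 < u y)%R}.
  apply: (ae_imp _ omega_le) => y; rewrite -lte_fin; apply: lt_le_trans.
  by rewrite mule_gt0 ?lte_fin// potential_gt0.
have /sigma_finiteP[E [E_T E_nd E_oo]] := sigma_finiteT sigma.
pose G n : set BX := E n `&` ([set y | (u y <= n%:R)%R] `&` [set y | (g y <= n%:R * u y `^ q)%R]).
have mG n : measurable (G n).
  apply: measurableI; first exact: (E_oo n).1.
  apply: measurableI; rewrite -[X in measurable X]setTI; apply: measurable_fun_le => //.
  by apply: measurable_funM => //; apply: (measurableT_comp (measurable_powR q)).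
have ndG : {homo G : n m / (n <= m)%N >-> n `<=` m}.
  move=> n m nm y [Ey [/= uy gy]]; split; first by move: Ey; apply/subsetPset/E_nd.
  split => /=; first by rewrite (le_trans uy)// ler_nat.
  by rewrite (le_trans gy)// ler_wpM2r ?powR_ge0// ler_nat.
have G_fin n : sigma (G n) < +oo.
  apply: le_lt_trans (E_oo n).2; apply: le_measure; rewrite ?inE//.
    exact: (E_oo n).1.
  by move=> y [].
have bound n : \int[omega]_x
    ((operator K sigma (fun y => (g y * \1_(G n) y)%:E) x) `^ p) <= M.
  apply: (@omega_energy_le g (G n) n%:R) => //; first by move=> y [_ []].
  by move=> y [_ []].
have G_ae : {ae sigma, forall y, (\bigcup_n G n) y}.
  apply: (ae_imp _ u_gt0) => y uy.
  have [N NE] : exists N, E N y by have : setT y by []; rewrite E_T => -[N _]; exists N.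
  pose m := maxn N (maxn (Num.truncn (u y)).+1 (Num.truncn (g y / u y `^ q)).+1).
  exists m => //; split; first by move: NE; apply/subsetPset/E_nd; exact: leq_maxl.
  split => /=.
    rewrite (le_trans (ltW (truncnS_gt _)))// ler_nat.
    by rewrite leq_max leq_max leqnn orbT.
  rewrite -ler_pdivrMr ?powR_gt0// (le_trans (ltW (truncnS_gt _)))// ler_nat.
  by rewrite leq_max leq_max leqnn !orbT.
pose gn n y : \bar R := (g y * \1_(G n) y)%:E.
have gn0 n y : 0 <= gn n y by rewrite lee_fin mulr_ge0.
have mgn n : measurable_fun [set: BX] (gn n).
  by apply/measurable_EFinP; apply: measurable_funM => //; exact: measurable_indic.
have ndgn y : {homo gn ^~ y : n m / (n <= m)%N >-> n <= m}.
  move=> n m nm; rewrite lee_fin ler_wpM2l// !indicE.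
  case: (boolP (y \in G n)) => [/set_mem Gy|//]; by rewrite mem_set//; exact: ndG Gy.
have lim_gn x : limn (fun n => operator K sigma (gn n) x) = operator K sigma (EFin \o g) x.
  rewrite -operator_limn//; apply: ge0_ae_eq_integral => //.
  - apply: measurable_K_mul; apply: (@emeasurable_fun_cvg _ BX R setT gn) => // y _.
    exact: ereal_nondecreasing_is_cvgn.
  - exact: measurable_K_mul.
  - move=> y _; rewrite mule_ge0//; apply: lime_ge; last exact: nearW.
    exact: ereal_nondecreasing_is_cvgn.
  - by move=> y _; rewrite mule_ge0.
  apply: (ae_imp _ G_ae) => y [N _ GN] _; congr (_ * _).
  apply/cvg_lim => //; apply: cvg_near_cst; near=> n.
  rewrite /gn indicE mem_set ?mulr1//; apply: ndG GN.
  by near: n; exact: nbhs_infty_ge.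
have -> : \int[omega]_x (operator K sigma (EFin \o g) x `^ p) =
    \int[omega]_x ((limn (fun n => operator K sigma (gn n) x)) `^ p).
  by apply: eq_integral => x _; rewrite lim_gn.
apply: (@integral_limn_poweR_le _ BX R omega setT (fun n => operator K sigma (gn n)) p) => //.
- by move=> n; exact: measurable_operator.
- by move=> n x; exact: operator_ge0.
- by move=> x n m nm; apply: le_operator => y; [exact: gn0|exact: ndgn].
Unshelve. all: by end_near. Qed.

(** * A solution implies the infinitesimal inequality *)
Lemma high_potential_le x y (a : R) : (0 < a)%R -> qball x a y ->
  high_potential omega x a <= (2 * kappa)%:E * potential K omega y.
Proof.
move=> a0 xy; have k0 := kappa_gt0; have k2 := kappa2_gt0.
rewrite high_potentialE ?(ltW a0)// /potential -ge0_integralZl ?lee_fin ?(ltW k2)//.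
apply: ge0_integral_mono => z _; first by rewrite inve_fin_ge0// le_max ltW.
rewrite (K_qdist y z); apply: lee_inve_scale => //.
apply: (le_trans (qdist_triangle y z x)); rewrite (qdist_sym y x).
rewrite (mulrC 2%R) -mulrA ler_pM2l// mulrDl mul1r lerD// le_max ?lexx ?orbT//.
by rewrite (_ : (qdist x y <= a)%R).
Qed.

Lemma low_potential_le x (a : R) :
  low_potential sigma x a <= operator K sigma (fun y => (\1_(qball x a) y)%:E) x.
Proof.
have mB := measurable_qball x a.
rewrite -[leRHS]mul1e -operator_layer//; last first.
  exact/measurable_EFinP/measurable_indic.
apply: ge0_integral_subset => // t; rewrite /= !in_itv/=.
- by case/andP => ->.
- by move=> _; rewrite mule_ge0 ?invsq_ge0// integral_ge0// => y _; rewrite lee_fin.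
move=> /andP[t0 ta]; rewrite mul1r mu_qball_invsq_ge0/= lee_wpmul2r ?invsq_ge0//.
have mt := measurable_qball x t.
rewrite integral_indic// setIidr//; apply: qballS; exact: ltW.
Qed.

(** By the superlevel argument for [r = rho(x, .)] it suffices to integrate over
    the points [z] of [S] at least as far from [x] as a given [y] in [S].  There
    [K(x,z) <= 2 kappa K(y,z)] and [u(z)^q >= w^q], so that [w^q] times the
    integral is at most [2 kappa K u^q (y) <= 2 kappa u(y) <= 4 kappa w]. *)
Lemma dyadic_shell_le (x : X) (w : R) (S : set BX) : (0 < w)%R ->
  measurable S ->
  (forall y, S y -> operator K sigma (fun y => (u y)%:E `^ q) y <= (u y)%:E) ->
  (forall y, S y -> (w <= u y < 2 * w)%R) ->
  \int[sigma]_(y in S) K x y <= (4 * kappa * w `^ (1 - q))%:E.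
Proof.
move=> w0 mS SK Sw; have k0 := kappa_gt0; have k2 := kappa2_gt0.
have q0 : (0 < q)%R by exact: lt_trans q1.
have wq : (0 < w `^ q)%R by rewrite powR_gt0.
apply: (@integral_superlevel_le _ BX R sigma (qdist x)) => //.
  by rewrite lee_fin !mulr_ge0 ?powR_ge0// ltW.
move=> y Sy; set A := S `&` _.
have mA : measurable A.
  apply: measurableI => //; rewrite -[X in measurable X]setTI.
  by apply: measurable_fun_le => //; exact: measurable_qdist.
have h : (w `^ q)%:E * \int[sigma]_(z in A) K x z <= (2 * kappa)%:E * (2 * w)%:E.
  apply: (@le_trans _ _ ((2 * kappa)%:E * (u y)%:E)); last first.
    rewrite lee_wpmul2l ?lee_fin ?(ltW k2)//.
    by have /andP[_ /ltW] := Sw _ Sy.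
  apply: (@le_trans _ _ ((2 * kappa)%:E * operator K sigma (fun y => (u y)%:E `^ q) y)); last first.
    by rewrite lee_wpmul2l ?lee_fin ?(ltW k2)// SK.
  have muq : measurable_fun [set: BX] (fun y => (u y)%:E `^ q).
    apply: (measurableT_comp (measurable_poweR q)); exact/measurable_EFinP.
  rewrite -ge0_integralZl ?lee_fin ?(ltW wq)//; last by apply: measurable_funTS; exact: measurable_K_section.
  rewrite /operator -ge0_integralZl ?lee_fin ?(ltW k2)//; last 2 first.
  - exact: measurable_K_mul.
  - by move=> z _; rewrite mule_ge0 ?K_ge0 ?poweR_ge0.
  apply: ge0_integral_subset => // z.
    by rewrite !mule_ge0 ?K_ge0 ?poweR_ge0// lee_fin ltW.
  move=> [Sz /= yz]; rewrite mule_ge0 ?K_ge0 ?lee_fin ?(ltW wq)//=.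
  rewrite muleC muleA; apply: lee_pmul => //; rewrite ?K_ge0 ?lee_fin ?(ltW wq)//.
    exact: K_le_far.
  apply: ge0_ler_powR; rewrite ?nnegrE ?(ltW q0) ?(ltW w0)//.
  by have /andP[] := Sw _ Sz.
rewrite (_ : \int[sigma]_(z in A) K x z =
  ((w `^ q)^-1)%:E * ((w `^ q)%:E * \int[sigma]_(z in A) K x z)); last first.
  by rewrite muleA -EFinM mulVf ?gt_eqF// mul1e.
apply: (le_trans (lee_wpmul2l _ h)); first by rewrite lee_fin invr_ge0 ltW.
rewrite -!EFinM lee_fin powRD; last by apply/implyP; rewrite (gt_eqF w0).
rewrite powRN powRr1 ?(ltW w0)//.
rewrite (_ : (w `^ q)^-1 * (2 * kappa * (2 * w)) = 4 * kappa * (w * (w `^ q)^-1))%R//.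
by ring.
Qed.

(** On [B_a(x)], [u >= eps K omega >= w] with [w = eps W_x(a) / (2 kappa)], so the
    dyadic shells of [u] above [w] cover the ball and [dyadic_shell_le] sums to
    [A_x(a) <= c w^(1-q)]. *)
Lemma solution_infinitesimal : infinitesimal_inequality K sigma omega p q.
Proof.
apply/infinitesimal_inequalityP.
have k0 := kappa_gt0; have k2 := kappa2_gt0.
have q0 : (0 < q)%R by exact: lt_trans q1.
have q10 : (0 < q - 1)%R by rewrite subr_gt0.
pose r : R := (2 `^ (1 - q))%R.
have r0 : (0 < r)%R by rewrite powR_gt0.
have r1 : (r < 1)%R.
  rewrite /r -opprB powRN invf_lt1 ?powR_gt0//.
  apply: (@le_lt_trans _ _ (1 `^ (q - 1))%R); first by rewrite powR1.
  by apply: gt0_ltr_powR; rewrite ?nnegrE ?ltr1n.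
pose e : R := (eps / (2 * kappa))%R.
have e0 : (0 < e)%R by rewrite divr_gt0.
pose c : R := (4 * kappa / (1 - r))%R.
have c0 : (0 < c)%R by rewrite divr_gt0 ?mulr_gt0 ?subr_gt0.
exists (c * e `^ (1 - q))%R; first by rewrite mulr_gt0// powR_gt0.
move=> x a a0.
have M0 : 0 <= (c * e `^ (1 - q))%:E by rewrite lee_fin mulr_ge0 ?powR_ge0// ltW.
have [N [mN N0 NP]] : sigma.-negligible (~` [set y |
    operator K sigma (fun y => (u y)%:E `^ q) y <= (u y)%:E /\
    eps%:E * potential K omega y <= (u y)%:E]).
  by apply: (ae_imp2 _ Ku_le omega_le) => y h1 h2; split.
have good y : ~ N y -> operator K sigma (fun y => (u y)%:E `^ q) y <= (u y)%:E /\
    eps%:E * potential K omega y <= (u y)%:E.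
  by move=> Ny; apply: contrapT => h; apply: Ny; exact: NP.
have mB := measurable_qball x a.
have uW y : qball x a y -> ~ N y -> e%:E * high_potential omega x a <= (u y)%:E.
  move=> xy /good[_]; apply: le_trans.
  apply: (le_trans (lee_wpmul2l _ (high_potential_le a0 xy))); first by rewrite lee_fin ltW.
  by rewrite muleA -EFinM /e divfK// gt_eqF.
have [Wfin|] := boolP (high_potential omega x a \is a fin_num); last first.
  rewrite ge0_fin_numE ?high_potential_ge0// -leNgt leye_eq => /eqP Wy.
  (* An infinite high potential would make [u] infinite on the ball. *)
  have B0 : sigma (qball x a) = 0.
    apply/eqP; rewrite eq_le measure_ge0 andbT -N0; apply: le_measure; rewrite ?inE//.
    move=> y xy; apply: contrapT => /(uW _ xy).
    by rewrite Wy gt0_muley// leye_eq.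
  suff -> : low_potential sigma x a = 0 by rewrite mul0e.
  apply: integral0_eq => t /=; rewrite in_itv/= => /andP[t0 ta].
  have : sigma (qball x t) <= sigma (qball x a) by apply: le_mu_qball; exact: ltW.
  by rewrite B0 => h; apply/eqP; rewrite mule_eq0 eq_le h measure_ge0.
have := high_potential_ge0 omega x a; rewrite le_eqVlt => /predU1P[W0|W0].
  by rewrite -W0 poweR0r ?mule0// gt_eqF.
set W := fine (high_potential omega x a).
have WE : high_potential omega x a = W%:E by rewrite /W fineK.
have W1 : (0 < W)%R by rewrite -lte_fin -WE.
pose w : R := (e * W)%R; have w0 : (0 < w)%R by rewrite mulr_gt0.
pose S k : set BX := (qball x a `\` N) `&`
  ([set y | (2 ^+ k * w <= u y)%R] `&` ~` [set y | (2 ^+ k.+1 * w <= u y)%R]).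
have mS k : measurable (S k).
  have mle (v : R) : measurable [set y : BX | (v <= u y)%R].
    by rewrite -[X in measurable X]setTI; exact: measurable_fun_le.
  apply: measurableI; first exact: measurableD.
  by apply: measurableI => //; exact: measurableC.
have shell k : \int[sigma]_(y in S k) K x y <= (4 * kappa * w `^ (1 - q) * r ^+ k)%:E.
  have wk : (0 < 2 ^+ k * w)%R by rewrite mulr_gt0// exprn_gt0.
  apply: (le_trans (@dyadic_shell_le x (2 ^+ k * w)%R (S k) wk (mS k) _ _)).
  - by move=> y [[_ Ny] _]; exact: (good _ Ny).1.
  - move=> y [_ [/= -> /negP]]; rewrite -ltNge exprS mulrA//.
  - rewrite powRM ?exprn_ge0 ?(ltW w0)// -!powR_mulrn ?ler0n ?(ltW r0)//.
    rewrite lee_fin le_eqVlt /r -!powRrM (mulrC k%:R); apply/orP; left; apply/eqP.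
    by ring.
have cover y : qball x a y -> ~ N y -> exists k, S k y.
  move=> xy Ny; have wu : (w <= u y)%R by have := uW _ xy Ny; rewrite WE -EFinM lee_fin.
  have ex : exists k, (u y < 2 ^+ k.+1 * w)%R.
    exists (Num.truncn (u y / w)); rewrite -ltr_pdivrMr// (lt_trans (truncnS_gt _))//.
    by rewrite -natrX ltr_nat ltn_expl.
  case: (ex_minnP ex) => k uk kmin; exists k; split; first by split.
  split => /=; last by apply/negP; rewrite -ltNge.
  case: k uk kmin => [|k] uk kmin; first by rewrite expr0 mul1r.
  by rewrite leNgt; apply/negP => /kmin; rewrite ltnn.
have low_le : low_potential sigma x a <= (c * w `^ (1 - q))%:E.
  apply: (le_trans (low_potential_le x a)).
  have mSk k : measurable_fun [set: BX] (fun y => (\1_(S k) y)%:E * K x y).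
    apply: emeasurable_funM => //; exact/measurable_EFinP/measurable_indic.
  have Sk0 k y : 0 <= (\1_(S k) y)%:E * K x y by rewrite mule_ge0 ?K_ge0// lee_fin.
  have Sser y : 0 <= \sum_(k <oo) ((\1_(S k) y)%:E * K x y) by exact: nneseries_ge0.
  apply: (@le_trans _ _ (\int[sigma]_y \sum_(k <oo) ((\1_(S k) y)%:E * K x y))).
    apply: ae_ge0_le_integral => //.
    - by move=> y _; rewrite mule_ge0 ?K_ge0// lee_fin.
    - by apply: measurable_K_mul; exact/measurable_EFinP/measurable_indic.
    - by apply: ge0_emeasurable_sum.
    exists N; split => // y /= h; apply: contrapT => Ny; apply: h => _.
    rewrite indicE; case: (boolP (y \in qball x a)) => [/set_mem xy|_]; last by rewrite mule0.
    have [k Sk] := cover y xy Ny.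
    apply: (@le_trans _ _ (\sum_(0 <= j < k.+1) ((\1_(S j) y)%:E * K x y))); last first.
      exact: nneseries_lim_ge.
    by rewrite big_nat_recr//= mule1 indicE mem_set// mul1e leeDr// sume_ge0.
  rewrite integral_nneseries//.
  apply: le_trans (lee_nneseries (v := fun k => (4 * kappa * w `^ (1 - q) * r ^+ k)%:E) _ _) _.
  - by move=> k _ _; apply: integral_ge0.
  - move=> k _; apply: le_trans (shell k).
    rewrite [leRHS]integral_mkcond; apply: ge0_integral_mono => // y _.
    by rewrite patchE indicE; case: (y \in S k); rewrite ?mul1e ?mul0e.
  apply: (le_trans (nneseries_geometric_le _ r0 r1)).
    by rewrite !mulr_ge0 ?powR_ge0// ltW.
  by rewrite lee_fin /c mulrAC.
rewrite WE poweR_EFin.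
apply: (le_trans (lee_wpmul2r _ low_le)); first by rewrite lee_fin powR_ge0.
rewrite -EFinM lee_fin /w powRM ?(ltW e0) ?(ltW W1)// -!mulrA.
rewrite -powRD; last by apply/implyP; rewrite (gt_eqF W1).
by rewrite (_ : 1 - q + (q - 1) = 0)%R ?powRr0 ?mulr1//; ring.
Qed.

End from_solution.

End equivalence.

End quasi_metric.

Theorem theorem1p2 (R : realType) (X : pmetricType R)
    (sigma omega : {sigma_finite_measure set (borelType X) -> \bar R})
    (K : X -> X -> \bar R) (p q : R) :
  quasi_metric_kernel K -> 1 < q -> p^-1 + q^-1 = 1 ->
  [<-> calZ K sigma q (potential K omega);
       infinitesimal_inequality K sigma omega p q
         /\ weighted_norm_inequality K sigma omega p;
       infinitesimal_inequality K sigma omega p q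
         /\ testing_inequality K sigma omega q;
       exists C : R, {ae sigma, forall x : X,
         (operator K sigma (fun y => potential K omega y `^ q) x
            <= C%:E * potential K omega x)%E
         /\ (potential K omega x < +oo)%E}].
Proof.
move=> [mK K_gt0 K_sym [kappa kappa1 K_quasi]] q1 pq; tfae.
- move=> [_ [eps eps0 [u [mu u0 ue]]]].
  have f0 := potential_ge0 K_gt0 omega.
  have op0 x : (0 <= operator K sigma (fun y => (u y)%:E `^ q) x)%E.
    by apply: operator_ge0 => // y; exact: poweR_ge0.
  have Ku_le : {ae sigma, forall x,
      (operator K sigma (fun y => (u y)%:E `^ q) x <= (u x)%:E)%E}.
    apply: (ae_imp _ ue) => x ->; rewrite leeDl// mule_ge0//.
    by rewrite lee_fin ltW.
  have omega_le : {ae sigma, forall x, (eps%:E * potential K omega x <= (u x)%:E)%E}.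
    by apply: (ae_imp _ ue) => x ->; rewrite gee0_abs// leeDr.
  split.
    exact: (solution_infinitesimal mK K_gt0 K_sym kappa1 K_quasi q1 pq eps0 mu u0 Ku_le omega_le).
  exact: (solution_norm mK K_gt0 K_sym kappa1 K_quasi q1 pq eps0 mu u0 Ku_le omega_le).
- move=> [inf_le norm_le]; split => //.
  exact: (weighted_norm_testing mK K_gt0 K_sym kappa1 K_quasi q1 pq norm_le).
- move=> [inf_le test_le].
  exact: (testing_supersolution mK K_gt0 kappa1 K_quasi q1 pq inf_le test_le).
- move=> [C HC]; apply: (supersolution_calZ mK K_gt0 q1 _ _ HC).
    exact: measurable_potential.
  exact: potential_ge0.
Qed.
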